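(* Let $n\ge1$ and let $X=(X_t)_{t\in[0,1]^n}$ be a real-valued random field. Let $\Box^n_tX(s)$ denote its rectangular increment, let $d_X(t,s)=\sqrt{\mathbb{E}|\Box^n_tX(s)|^2}$, assumed finite, and suppose there are constants $C_0>0$ and $\iota\ge0$ such that for all $p\ge1$ and all $s,t\in[0,1]^n$ $$\mathbb{E}|\Box^n_tX(s)|^p\le C_0^p\,p^{p\iota}\,d_X(t,s)^p .$$ Let $\alpha=(\alpha_1,\ldots,\alpha_n)$ with $\alpha_j>0$. Then $X$ (up to modification) is jointly H\''older continuous of any order $\gamma=(\gamma_1,\ldots,\gamma_n)$ with $\gamma_j<\alpha_j$, i.e. for any $\epsilon=(\epsilon_1,\ldots,\epsilon_n)$ with all $\epsilon_j>0$ there is an almost surely finite random variable $C_\epsilon(\omega)$ such that almost surely, for all $s,t\in[0,1]^n$ with $s_j\neq t_j$ for all $j$, $$|\Box^n_tX(s)|\le C_\epsilon(\omega)\prod_{j=1}^n|t_j-s_j|^{\alpha_j-\epsilon_j},$$ if and only if for any $\epsilon=(\epsilon_1,\ldots,\epsilon_n)$ with all $\epsilon_j>0$ there is a constant $C_\epsilon>0$ such that for all $s,t\in[0,1]^n$ with $s_j\ne t_j$ for all $j$ $$d_X^2(t,s)\le C_\epsilon\prod_{j=1}^n|t_j-s_j|^{2\alpha_j-\epsilon_j}.$$ Moreover, in this case (if $\iota>0$) for every such $\epsilon$ the H\''older constant $C_\epsilon(\omega)=\sup\frac{|\Box^n_tX(s)|}{\prod_{j=1}^n|t_j-s_j|^{\alpha_j-\epsilon_j}}$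 of $X$, the supremum being over $s,t\in[0,1]^n$ with $s_j\ne t_j$ for all $j$, satisfies $$\mathbb{E}\exp\left(\beta\,C_\epsilon(\omega)^{1/\iota}\right)<\infty$$ for small enough $\beta>0$ which depends only on $C_0$, $\alpha$, $\iota$, and $\epsilon$.
   Context: For $x,y\in\mathbb{R}^n$ and $k=1,\ldots,n$ put $V_{k,y}x=(x_1,\ldots,x_{k-1},y_k,x_{k+1},\ldots,x_n)$, and for a function $f$ put $V_{k,y}f(x)=f(V_{k,y}x)$; these operators commute in $k$. The joint (rectangular) increment of $f$ is $\Box^n_yf(x)=\prod_{k=1}^n(I-V_{k,y})f(x)$, where $I$ is the identity operator. A modification of $X$ is a field $\tilde X$ on the same probability space with $P(\tilde X_t=X_t)=1$ for every $t$; ''up to modification'' means that $X$ has a modification, still denoted $X$, with the stated property.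
   Formalization: The threshold for β may depend also on the constants C_ε in the bound on d_X², not only on C_0, α, ι, ε: with X_t = ctN, N standard Gaussian, n=1, α=1, ι=1/2, the Hölder constant is |cN| while C_0 does not depend on c, so the English dependence fails. *)

(* Defs.v *)
From HB Require Import structures.
From mathcomp Require Import all_boot all_order all_algebra.
From mathcomp Require Import all_classical all_reals all_analysis.
From mathcomp Require Import measurable_realfun.
Import Order.TTheory GRing.Theory Num.Theory.
Import numFieldNormedType.Exports.

Set Implicit Arguments.
Unset Strict Implicit.
Unset Printing Implicit Defensive.

Local Open Scope classical_set_scope.
Local Open Scope ring_scope.

Section increments.
Context {R : realType} {n : nat}.
Implicit Types (s t x y : 'rV[R]_n) (f : 'rV[R]_n -> R) (k : 'I_n).

Definition cube : set 'rV[R]_n := [set x | forall j, 0 <= x ord0 j <= 1].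

Definition apart s t : Prop := forall j, s ord0 j != t ord0 j.

Definition subst_coord k y x : 'rV[R]_n :=
  \row_j (if j == k then y ord0 j else x ord0 j).

Definition V k y f : 'rV[R]_n -> R := fun x => f (subst_coord k y x).

(* The composition of the n operators I - V_{k,y}; these commute, so the order
   in which \big composes them is irrelevant. *)
Definition box y : ('rV[R]_n -> R) -> 'rV[R]_n -> R :=
  \big[(fun A B => A \o B) / id]_(k < n) (fun f x => f x - V k y f x).

Definition prod_dist (e : 'I_n -> R) s t : R :=
  \prod_(j < n) `|t ord0 j - s ord0 j| `^ e j.

End increments.

(* A random field on the cube is a total function on 'rV[R]_n, of which only the
   values at points of the cube matter: the cube is stable under subst_coord. *)
Section fields.
Context {R : realType} {n : nat} {d : measure_display} {T : measurableType d}.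
Variable P : probability T R.
Implicit Types (X Y : 'rV[R]_n -> T -> R) (s t : 'rV[R]_n).

Definition random_field X : Prop :=
  forall t, cube t -> measurable_fun [set: T] (X t).

Definition modification X Y : Prop :=
  random_field Y /\ forall t, cube t -> P [set w | Y t w = X t w] = 1%E.

Definition increment X t s (w : T) : R := box t (fun u => X u w) s.

Definition square_integrable_increments X : Prop :=
  forall s t, cube s -> cube t ->
    ('E_P[fun w => (`|increment X t s w| ^+ 2)%R] < +oo)%E.

Definition dX X t s : R :=
  Num.sqrt (fine 'E_P[fun w => (`|increment X t s w| ^+ 2)%R]).

Definition moment_growth (C0 iota : R) X : Prop :=
  forall p : R, 1 <= p -> forall s t, cube s -> cube t ->
    ('E_P[fun w => (`|increment X t s w| `^ p)%R]
       <= (C0 `^ p * p `^ (p * iota) * dX X t s `^ p)%:E)%E.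

Definition jointly_holder (alpha : 'I_n -> R) X : Prop :=
  forall eps : 'I_n -> R, (forall j, 0 < eps j) ->
  exists C : T -> \bar R,
    [/\ measurable_fun [set: T] C,
        {ae P, forall w, C w \is a fin_num} &
        {ae P, forall w, forall s t, cube s -> cube t -> apart s t ->
          (`|increment X t s w|%:E
             <= C w * (prod_dist (fun j => (alpha j - eps j)%R) s t)%:E)%E}].

Definition dX_bound (alpha eps : 'I_n -> R) (C : R) X : Prop :=
  forall s t, cube s -> cube t -> apart s t ->
    dX X t s ^+ 2 <= C * prod_dist (fun j => 2 * alpha j - eps j) s t.

Definition holder_constant (alpha eps : 'I_n -> R) X (w : T) : \bar R :=
  ereal_sup [set (`|increment X st.2 st.1 w|
                  / prod_dist (fun j => alpha j - eps j) st.1 st.2)%:E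
            | st in [set st | [/\ cube st.1, cube st.2 & apart st.1 st.2]]].

End fields.

(* Main.v *)
(* Write [gam = alpha - eps].  For the elementary dyadic rectangles of all levels,
   the moment hypothesis and the bound on [d_X] give summable moments of the
   increments divided by [prod_j |I_j| ^ gam_j]; their supremum [M] over all
   rectangles therefore has finite moments (and exponential moments of order
   [1 / iota]).  One-dimensional chaining, applied to one coordinate at a time,
   turns [M] into a Hoelder bound for the increments with dyadic corners.  The
   field [reduct X t], the increment of [X] between the origin and [t], has the
   same rectangular increments as [X], and is uniformly continuous on dyadic
   points; replacing it by its continuous extension gives the modification.
   Conversely, moments of order 4 make [d_X] comparable, on any event of
   probability close to 1, with a bound for the increment on that event. *)

Require Import Defs.
From HB Require Import structures.
From mathcomp Require Import all_boot all_order all_algebra.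
From mathcomp Require Import all_classical all_reals all_analysis.
From mathcomp Require Import measurable_realfun.
From mathcomp Require Import ring lra zify.
Import Order.TTheory GRing.Theory Num.Theory.
Import numFieldNormedType.Exports.

Local Open Scope classical_set_scope.
Local Open Scope ring_scope.

Set Implicit Arguments.
Unset Strict Implicit.
Unset Printing Implicit Defensive.

(** * Rectangular increments *)

(** Rectangular increments ignore every summand of the field that is constant in some coordinate,
    and such summands may be arbitrarily irregular. Hence no continuous version of [X] itself can be
    expected: only [reduct X] is made regular, while [X - reduct X], which is invisible to [box],
    stays as it is. The bound on [dX] has exponents [alpha - eps / 2], so dividing by the side
    lengths to the power [alpha - eps] leaves a spare factor [|I_j| ^ (eps_j / 2)]. In a moment of
    order at least [4 / eps_j] this becomes at most [|I_j| ^ 2], which is summable over the [2 ^ m]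
    intervals of each level [m]. Moments of smaller order are recovered from [x ^ q <= 1 + x ^ p]
    for [0 <= q <= p]. For the exponential moment, [p = k / iota] turns [p ^ (p * iota)] into
    [k ^ k] up to a geometric factor; since [k ^ k <= e ^ k * k!], the exponential series converges
    for small [beta]. This is where the power [1 / iota] comes from. Regularity on dyadic points
    says nothing about [X] elsewhere; convergence in mean along truncations ties the extension to
    [X] at every fixed point. *)

Section box_algebra.
Context {R : realType} {n : nat}.
Implicit Types (s t x y z : 'rV[R]_n) (f g : 'rV[R]_n -> R) (k : 'I_n).
Implicit Types (l : seq 'I_n).

Definition upd k (v : R) x : 'rV[R]_n := \row_j (if j == k then v else x ord0 j).

Lemma updE k v x j : upd k v x ord0 j = if j == k then v else x ord0 j.
Proof. by rewrite mxE. Qed.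

Lemma row_ext x y : (forall j, x ord0 j = y ord0 j) -> x = y.
Proof. by move=> xy; apply/rowP => j; rewrite xy. Qed.

Lemma subst_coordE k y x : subst_coord k y x = upd k (y ord0 k) x.
Proof. by apply: row_ext => j; rewrite !mxE; case: eqP => // ->. Qed.

Lemma upd_upd k u v x : upd k u (upd k v x) = upd k u x.
Proof. by apply: row_ext => j; rewrite !mxE; case: eqP. Qed.

Lemma updC k k' u v x : k != k' -> upd k u (upd k' v x) = upd k' v (upd k u x).
Proof.
move=> kk'; apply: row_ext => j; rewrite !mxE.
by case: eqP => // ->; rewrite (negbTE kk').
Qed.

Lemma upd_id k x : upd k (x ord0 k) x = x.
Proof. by apply: row_ext => j; rewrite mxE; case: eqP => // ->. Qed.

Lemma cube_upd k v x : 0 <= v <= 1 -> cube x -> cube (upd k v x).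
Proof. by move=> v01 cx j; rewrite updE; case: ifP. Qed.

Definition diffop y k f : 'rV[R]_n -> R := fun x => f x - V k y f x.

(** Working over a list of directions makes [box] accessible to induction and lets a single
    direction be pulled out of the composition. *)
Definition boxl l y f : 'rV[R]_n -> R := foldr (diffop y) f l.

Lemma boxE t f : box t f = boxl (index_enum 'I_n) t f.
Proof.
rewrite /box; elim: (index_enum _) => [|k l IH]; first by rewrite big_nil.
by rewrite big_cons /= IH.
Qed.

Lemma diffopE y k f x : diffop y k f x = f x - f (upd k (y ord0 k) x).
Proof. by rewrite /diffop /V subst_coordE. Qed.

Lemma diffopC y z k k' f : k != k' ->
  diffop y k (diffop z k' f) = diffop z k' (diffop y k f).
Proof.
move=> kk'; apply/funext => x; rewrite !diffopE [upd k' _ (upd k _ _)]updC 1?eq_sym//.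
by ring.
Qed.

(** The term that [diffop z k] subtracts is constant in coordinate [k], so [diffop y k] annihilates
    it. *)
Lemma diffop_id y z k f : diffop y k (diffop z k f) = diffop y k f.
Proof. by apply/funext => x; rewrite !diffopE !upd_upd; ring. Qed.

Lemma boxl_diffop l y z k f : k \notin l ->
  boxl l y (diffop z k f) = diffop z k (boxl l y f).
Proof.
elim: l => //= k' l IH; rewrite inE negb_or => /andP[kk' kl].
by rewrite IH// diffopC 1?eq_sym.
Qed.

Lemma boxl_idem l y z f : uniq l -> boxl l y (boxl l z f) = boxl l y f.
Proof.
elim: l f => //= k l IH f /andP[kl ul].
by rewrite boxl_diffop// diffop_id IH.
Qed.

Lemma boxl_rem l y k f : k \in l -> boxl l y f = diffop y k (boxl (rem k l) y f).
Proof.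
elim: l => //= k' l IH; rewrite inE; case: eqVneq => [->//|/= kk' kl].
by rewrite IH// diffopC// eq_sym.
Qed.

Lemma eq_boxl l y z f : (forall j, j \in l -> y ord0 j = z ord0 j) ->
  boxl l y f = boxl l z f.
Proof.
elim: l => //= k l IH yz; rewrite IH; last by move=> j jl; rewrite yz// inE jl orbT.
by apply/funext => x; rewrite !diffopE yz// inE eqxx.
Qed.

Lemma box_idem y z f : box y (box z f) = box y f.
Proof. by rewrite !boxE boxl_idem// index_enum_uniq. Qed.

Lemma boxB y f g x : box y (fun u => f u - g u) x = box y f x - box y g x.
Proof.
rewrite !boxE; elim: (index_enum _) x => //= k l IH x.
by rewrite !diffopE !IH; ring.
Qed.

(** In a single direction [box] is an ordinary difference: [G] has already taken the differences in
    all the others. Every reduction to one dimension goes through this. *)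
Lemma box_slice k s t f : exists G : R -> R,
  forall u v, box (upd k v t) f (upd k u s) = G u - G v.
Proof.
have kI : k \in index_enum 'I_n by rewrite mem_index_enum.
exists (fun u => boxl (rem k (index_enum 'I_n)) t f (upd k u s)) => u v.
rewrite boxE (boxl_rem _ _ kI) diffopE updE eqxx upd_upd.
rewrite (@eq_boxl _ _ t)// => j; rewrite mem_rem_uniq ?index_enum_uniq//.
by rewrite inE updE => /andP[/negbTE->].
Qed.

Lemma box_eq0 k s t f : s ord0 k = t ord0 k -> box t f s = 0.
Proof.
move=> st; have [G GE] := box_slice k s t f.
by rewrite -(upd_id k s) -{1}(upd_id k t) GE st subrr.
Qed.

Lemma box_map (h : R -> R) t f s :
  box t (f \o map_mx h) s = box (map_mx h t) f (map_mx h s).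
Proof.
rewrite !boxE; elim: (index_enum _) s => //= k l IH s.
rewrite !diffopE !IH mxE; congr (_ - boxl _ _ _ _).
by apply: row_ext => j; rewrite !mxE; case: ifP.
Qed.

(* The part of [f] seen by [box]: it has the same rectangular increments as [f]
   and vanishes on the faces through the origin. *)
Definition reduct f := box (0 : 'rV[R]_n) f.

Lemma box_reduct t f : box t (reduct f) = box t f.
Proof. exact: box_idem. Qed.

(** With [G] the slice in direction [k], the right side is [(G u - G 0) - (G v - G 0)] for [u] the
    coordinate of [x], and the terms at the origin cancel. *)
Lemma box_axis k v f x :
  box (upd k v 0) f x = reduct f x - reduct f (upd k v x).
Proof.
have [G GE] := box_slice k x 0 f.
have R0 : (0 : 'rV[R]_n) = upd k 0 0 by apply: row_ext => j; rewrite !mxE; case: ifP.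
rewrite /reduct -[in LHS](upd_id k x) -[in X in X - _](upd_id k x).
by rewrite {2 3}R0 !GE; ring.
Qed.

Definition mixed (m : nat) y x : 'rV[R]_n :=
  \row_j (if (j < m)%N then y ord0 j else x ord0 j).

(** The points [mixed m y x] form a staircase from [x] to [y]; each step changes one coordinate and
    is a single rectangular increment by [box_axis]. *)
Lemma reduct_telescope f x y :
  reduct f x - reduct f y =
  \sum_(k < n) box (upd k (y ord0 k) 0) f (mixed k y x).
Proof.
have E : (forall k : 'I_n, box (upd k (y ord0 k) 0) f (mixed k y x) =
    reduct f (mixed k y x) - reduct f (mixed k.+1 y x)).
  move=> k; rewrite box_axis; congr (_ - reduct _ _).
  apply: row_ext => j; rewrite !mxE ltnS.
  have [->|jk] := eqVneq j k; first by rewrite leqnn.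
  by rewrite [in RHS]leq_eqVlt val_eqE (negbTE jk).
rewrite (eq_bigr _ (fun k _ => E k)).
rewrite -(big_mkord xpredT (fun m => reduct f (mixed m y x) - reduct f (mixed m.+1 y x))).
rewrite (eq_bigr (fun m => - reduct f (mixed m.+1 y x) - - reduct f (mixed m y x))); last by move=> i _; ring.
rewrite telescope_sumr//.
have -> : mixed n y x = y by apply: row_ext => j; rewrite mxE ltn_ord.
have -> : mixed 0 y x = x by apply: row_ext => j; rewrite mxE.
by ring.
Qed.

Lemma cube_mixed m y x : cube y -> cube x -> cube (mixed m y x).
Proof. by move=> cy cx j; rewrite mxE; case: ifP. Qed.

Lemma cube0 : cube (0 : 'rV[R]_n).
Proof. by move=> j; rewrite mxE lexx ler01. Qed.

End box_algebra.

Lemma onepowR {R : realType} (a : R) : 1 `^ a = 1.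
Proof. by rewrite powR1. Qed.

Section box_bounds.
Context {R : realType} {n : nat}.
Implicit Types (s t x y z : 'rV[R]_n) (f g : 'rV[R]_n -> R) (k : 'I_n).
Implicit Types (gam : 'I_n -> R).

Lemma prod_dist_ge0 gam s t : 0 <= prod_dist gam s t.
Proof. by apply: prodr_ge0 => j _; rewrite powR_ge0. Qed.

Lemma prod_dist_gt0 gam s t : apart s t -> 0 < prod_dist gam s t.
Proof. by move=> st; apply: prodr_gt0 => j _; rewrite powR_gt0// normr_gt0 subr_eq0 eq_sym. Qed.

Lemma prod_dist_upd gam k u v s t :
  prod_dist gam (upd k u s) (upd k v t) =
  (\prod_(j < n | j != k) `|t ord0 j - s ord0 j| `^ gam j) * `|v - u| `^ gam k.
Proof.
rewrite /prod_dist (bigD1 k)//= !updE eqxx mulrC; congr (_ * _).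
by apply: eq_bigr => j /negbTE jk; rewrite !updE jk.
Qed.

(** Induction on the number [m] of directions already passed from the relation [e] to the relation
    [D]: directions below [m] range over [D], the others still over [e], and each passage costs one
    factor [c j]. *)
Lemma box_upgrade (e D : R -> R -> Prop) gam (c : 'I_n -> R) (M : R) f :
  (forall j, 0 <= c j) -> 0 <= M ->
  (forall j (G : R -> R) (B : R), 0 <= B ->
    (forall a b, e a b -> `|G a - G b| <= B * `|b - a| `^ gam j) ->
    forall a b, D a b -> `|G a - G b| <= c j * B * `|b - a| `^ gam j) ->
  (forall s t, (forall j, e (s ord0 j) (t ord0 j)) ->
    `|box t f s| <= M * prod_dist gam s t) ->
  forall s t, (forall j, D (s ord0 j) (t ord0 j)) ->
    `|box t f s| <= (\prod_j c j) * M * prod_dist gam s t.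
Proof.
move=> c0 M0 up base.
suff H m : (m <= n)%N -> forall s t,
    (forall j : 'I_n, if (j < m)%N then D (s ord0 j) (t ord0 j) else e (s ord0 j) (t ord0 j)) ->
    `|box t f s| <= (\prod_(j < n | (j < m)%N) c j) * M * prod_dist gam s t.
  move=> s t st; rewrite (eq_bigl (fun j : 'I_n => (j < n)%N)); last by move=> j; rewrite ltn_ord.
  by apply: (H n (leqnn n)) => j; rewrite ltn_ord.
elim: m => [_|m IH mn] s t st.
  by rewrite big_pred0// mul1r; apply: base => j; exact: (st j).
pose k := Ordinal mn; have [G GE] := box_slice k s t f.
(* The sides in the directions other than [k] are frozen, so their factors belong to the constant of
   a one-dimensional estimate. *)
pose B := (\prod_(j < n | (j < m)%N) c j) * M *
          \prod_(j < n | j != k) `|t ord0 j - s ord0 j| `^ gam j.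
have B0 : 0 <= B.
  by rewrite !mulr_ge0//; apply: prodr_ge0 => // j _; rewrite powR_ge0.
have Ge a b : e a b -> `|G a - G b| <= B * `|b - a| `^ gam k.
  move=> eab; rewrite -GE -mulrA -prod_dist_upd; apply: IH; first exact: ltnW.
  move=> j; have := st j; rewrite ltnS leq_eqVlt !updE -val_eqE /=.
  by case: eqVneq => [->|]; rewrite ?ltnn.
have := up k G B B0 Ge (s ord0 k) (t ord0 k).
rewrite -GE !upd_id => /(_ _)/le_trans; apply; first by have := st k; rewrite ltnSn.
rewrite /B -2!mulrA -prod_dist_upd !upd_id !mulrA [X in _ <= X * _ * _](bigD1 k) /= ?ltnSn//.
rewrite le_eqVlt; apply/orP; left; apply/eqP; congr (_ * _ * _ * _).
apply: eq_bigl => j; have [->|jk] := eqVneq j k; first by rewrite ltnn andbF.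
have -> : (j < m.+1)%N = (nat_of_ord j == k) || (j < m)%N by rewrite ltnS leq_eqVlt.
by rewrite val_eqE (negbTE jk) andbT.
Qed.

(* Since [reduct f] vanishes on the faces, moving one coordinate at a time
   expresses its increments by rectangular increments of [f]. *)
Lemma reduct_holder (D : set R) gam (c : R) f :
  D 0 -> (forall u, D u -> 0 <= u <= 1) -> (forall j, 0 < gam j) -> 0 <= c ->
  (forall s t, (forall j, D (s ord0 j)) -> (forall j, D (t ord0 j)) -> apart s t ->
    `|box t f s| <= c * prod_dist gam s t) ->
  forall x y, (forall j, D (x ord0 j)) -> (forall j, D (y ord0 j)) ->
    `|reduct f x - reduct f y| <= c * \sum_k `|y ord0 k - x ord0 k| `^ gam k.
Proof.
move=> D0 D01 g0 c0 H x y Dx Dy; rewrite reduct_telescope mulr_sumr.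
apply: le_trans (ler_norm_sum _ _ _) _; apply: ler_sum => k _.
set s := mixed k y x; set t := upd k _ _.
have Ds j : D (s ord0 j) by rewrite mxE; case: ifP.
have Dt j : D (t ord0 j) by rewrite !mxE; case: ifP.
have [st|] := pselect (apart s t); last first.
  move=> /existsNP[j /negP]; rewrite negbK => /eqP /box_eq0 ->.
  by rewrite normr0 mulr_ge0// powR_ge0.
apply: le_trans (H s t Ds Dt st) _; rewrite ler_wpM2l//.
(* All sides have length at most 1 and the exponents are positive, so only the factor in direction
   [k] is kept. *)
rewrite /prod_dist (bigD1 k)//= /t /s updE eqxx mxE ltnn.
rewrite ler_piMr ?powR_ge0//; apply: prodr_ile1 => j _; rewrite powR_ge0 /=.
rewrite -[leRHS](onepowR (gam j)) ge0_ler_powR ?nnegrE// ?(ltW (g0 j))// ler_norml.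
by have := D01 _ (Ds j); have := D01 _ (Dt j); lra.
Qed.

End box_bounds.

(** * Dyadic points and chaining *)

Section dyadic.
Context {R : realType}.
Implicit Types (x y a b : R) (m : nat).

Definition dytrunc m x : R := (Num.truncn (x * 2 ^+ m))%:R / 2 ^+ m.

Definition dyadic x : Prop := exists m i, (i <= 2 ^ m)%N /\ x = i%:R / 2 ^+ m.

Definition elementary a b : Prop :=
  exists m i, [/\ (i < 2 ^ m)%N, a = i%:R / 2 ^+ m & b = i.+1%:R / 2 ^+ m].

Lemma exp2_gt0 m : 0 < 2 ^+ m :> R.
Proof. by rewrite exprn_gt0. Qed.
Local Hint Resolve exp2_gt0 : core.

Lemma exp2_neq0 m : 2 ^+ m != 0 :> R.
Proof. by rewrite gt_eqF. Qed.
Local Hint Resolve exp2_neq0 : core.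

Lemma dytrunc_itv m x : 0 <= x -> dytrunc m x <= x < dytrunc m x + 2 ^- m.
Proof.
move=> x0; have /truncn_itv/andP[h1 h2] : 0 <= x * 2 ^+ m by rewrite mulr_ge0// ltW.
by rewrite /dytrunc -[X in _ + X]mul1r -mulrDl ler_pdivrMr// ltr_pdivlMr// h1 natr1.
Qed.

Lemma truncn_le_exp2 m x : 0 <= x <= 1 -> (Num.truncn (x * 2 ^+ m) <= 2 ^ m)%N.
Proof.
move=> /andP[x0 x1]; rewrite -(ler_nat R) natrX.
have /truncn_itv/andP[h1 _] : 0 <= x * 2 ^+ m by rewrite mulr_ge0// ltW.
by apply: le_trans h1 _; rewrite ler_piMl// ltW.
Qed.

Lemma dyadic_dytrunc m x : 0 <= x <= 1 -> dyadic (dytrunc m x).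
Proof. by move=> x01; exists m, (Num.truncn (x * 2 ^+ m)); rewrite truncn_le_exp2. Qed.

Lemma dyadic_bounds x : dyadic x -> 0 <= x <= 1.
Proof.
move=> [m [i [im ->]]]; rewrite divr_ge0 ?(ltW (exp2_gt0 _))//= ler_pdivrMr// mul1r -natrX.
by rewrite ler_nat.
Qed.

Lemma dyadic0 : dyadic 0.
Proof. by exists 0%N, 0%N; rewrite mul0r. Qed.

Lemma dytrunc_dyadic x : dyadic x -> exists m0, forall m, (m0 <= m)%N -> dytrunc m x = x.
Proof.
move=> [m0 [i [_ ->]]]; exists m0 => m /subnKC <-; rewrite /dytrunc exprD mulrA.
rewrite divfK// -natrX -natrM natrK natrM natrX; field.
by rewrite !exp2_neq0.
Qed.

Lemma dytrunc_step m x : 0 <= x <= 1 ->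
  dytrunc m.+1 x = dytrunc m x \/
  exists i, [/\ (i < 2 ^ m.+1)%N, dytrunc m x = i%:R / 2 ^+ m.+1 &
                dytrunc m.+1 x = i.+1%:R / 2 ^+ m.+1].
Proof.
move=> x01; have /andP[x0 _] := x01; have x2 : 0 <= x * 2 ^+ m by rewrite mulr_ge0// ltW.
set q := Num.truncn (x * 2 ^+ m); have /truncn_itv/andP[h1 h2] := x2.
have E : dytrunc m x = (2 * q)%:R / 2 ^+ m.+1.
  by rewrite /dytrunc -/q exprS natrM; field.
have [lt|ge] := ltP (x * 2 ^+ m.+1) (2 * q).+1%:R.
  left; rewrite E /dytrunc; congr (_%:R / _); apply: truncn_def.
  by rewrite lt andbT natrM exprS mulrCA ler_pM2l.
right; exists (2 * q)%N; have F : Num.truncn (x * 2 ^+ m.+1) = (2 * q).+1.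
  apply: truncn_def; rewrite ge /= exprS mulrCA.
  rewrite (_ : (2 * q).+2 = 2 * q.+1)%N; last by lia.
  by rewrite natrM ltr_pM2l.
by split => //; [rewrite -F; exact: truncn_le_exp2|rewrite /dytrunc F].
Qed.

Lemma dytrunc_near m x y : 0 <= x <= 1 -> 0 <= y <= 1 -> x <= y <= x + 2 ^- m ->
  dytrunc m y = dytrunc m x \/
  exists i, [/\ (i < 2 ^ m)%N, dytrunc m x = i%:R / 2 ^+ m &
                dytrunc m y = i.+1%:R / 2 ^+ m].
Proof.
move=> x01 y01 /andP[xy yx]; have /andP[x0 _] := x01.
have x2 : 0 <= x * 2 ^+ m by rewrite mulr_ge0// ltW.
have y2 : y * 2 ^+ m <= x * 2 ^+ m + 1.
  by rewrite -ler_pdivlMr// mulrDl mulfK// mul1r.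
have xy2 : x * 2 ^+ m <= y * 2 ^+ m by rewrite ler_pM2r.
rewrite /dytrunc; set q := Num.truncn (x * 2 ^+ m).
have /truncn_itv/andP[h1 h2] := x2; rewrite -/q in h1 h2.
have [lt|ge] := ltP (y * 2 ^+ m) q.+1%:R.
  by left; congr (_%:R / _); apply: truncn_def; rewrite lt andbT; lra.
have F : Num.truncn (y * 2 ^+ m) = q.+1.
  by apply: truncn_def; rewrite ge /= -natr1; lra.
by right; exists q; rewrite F; split => //; rewrite -F truncn_le_exp2.
Qed.

Lemma exists_scale x : 0 < x <= 1 -> exists m, 2 ^- m.+1 < x <= 2 ^- m.
Proof.
move=> /andP[x0 x1].
have ex : exists m, (2 ^- m.+1 < x).
  exists (Num.truncn x^-1); rewrite invf_plt ?posrE//.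
  apply: lt_trans (truncnS_gt _) _; rewrite -natrX ltr_nat.
  exact: ltn_expl.
case: (ex_minnP ex) => m mx min; exists m; rewrite mx /=.
case: m min {mx} => [_|m min]; first by rewrite invr1.
by rewrite leNgt; apply/negP => /min; rewrite ltnn.
Qed.

(** With [r = 2^-1 ^ gam], the numerator counts one bridging step and two geometric tails, in units
    of [r ^ m]. Dividing by [r] changes [r ^ m] into [r ^ m.+1], which is comparable with the
    distance of the two points. *)
Definition chain_const (gam : R) : R :=
  (1 + 2 / (1 - 2^-1 `^ gam)) / (2^-1 `^ gam).

Lemma chain_const_ge0 gam : 0 < gam -> 0 <= chain_const gam.
Proof.
move=> g0; have r1 : 2^-1 `^ gam <= 1 :> R.
  by rewrite -[leRHS](onepowR gam) ge0_ler_powR ?nnegrE ?(ltW g0)// invf_le1 ?ler1n.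
by rewrite divr_ge0 ?powR_ge0// addr_ge0// divr_ge0// subr_ge0.
Qed.

Lemma powR_exp2V gam m : (2 ^- m : R) `^ gam = (2^-1 `^ gam) ^+ m.
Proof.
rewrite -exprVn; elim: m => [|m IH]; first by rewrite !expr0 onepowR.
by rewrite !exprS powRM ?IH// exprn_ge0.
Qed.

(* One-dimensional chaining: two points at distance at most [2 ^- m] have equal
   or adjacent truncations at level [m], and successive truncations of a dyadic
   point differ by at most one elementary step. *)
Lemma chaining (gam B : R) (G : R -> R) : 0 < gam -> 0 <= B ->
  (forall a b, elementary a b -> `|G a - G b| <= B * `|b - a| `^ gam) ->
  forall a b, dyadic a /\ dyadic b ->
    `|G a - G b| <= chain_const gam * B * `|b - a| `^ gam.
Proof.
move=> g0 B0 H; set r : R := 2^-1 `^ gam.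
have r0 : 0 < r by rewrite powR_gt0.
have r1 : r < 1.
  by rewrite -[X in _ < X](onepowR gam) gt0_ltr_powR ?nnegrE// invf_lt1// ltr1n.
have el m i : (i < 2 ^ m)%N -> `|G (i%:R / 2 ^+ m) - G (i.+1%:R / 2 ^+ m)| <= B * r ^+ m.
  move=> im; apply: le_trans (H _ _ _) _; first by exists m, i.
  rewrite -mulrBl -natrB// subSnn mul1r ger0_norm ?invr_ge0 ?(ltW (exp2_gt0 _))//.
  by rewrite powR_exp2V.
have step m x : 0 <= x <= 1 -> `|G (dytrunc m x) - G (dytrunc m.+1 x)| <= B * r ^+ m.+1.
  move=> /(dytrunc_step m)[->|[i [im -> ->]]]; last exact: el.
  by rewrite subrr normr0 mulr_ge0// exprn_ge0// ltW.
have chain m l x : 0 <= x <= 1 ->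
    `|G (dytrunc m x) - G (dytrunc (m + l) x)| <= B * (r ^+ m - r ^+ (m + l)) / (1 - r).
  move=> x01; elim: l => [|l IH]; first by rewrite addn0 !subrr normr0 mulr0 mul0r.
  rewrite addnS; apply: le_trans (ler_distD (G (dytrunc (m + l) x)) _ _) _.
  apply: le_trans (lerD IH (step _ _ x01)) _.
  have rml : 0 <= B * r ^+ (m + l) by rewrite mulr_ge0// exprn_ge0// ltW.
  rewrite exprS -subr_ge0 (_ : _ - _ = (1 - r) * (B * r ^+ (m + l))); first by rewrite mulr_ge0// subr_ge0 ltW.
  by field; lra.
(* A dyadic point equals its truncations from some level on, so a finite chain reaches [G x] without
   any continuity of [G]. *)
have far m x : dyadic x -> `|G (dytrunc m x) - G x| <= B * r ^+ m / (1 - r).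
  move=> dx; have x01 := dyadic_bounds dx; have [m0 /(_ (m + m0)%N) E] := dytrunc_dyadic dx.
  have := chain m m0 x x01; rewrite E ?leq_addl// => /le_trans; apply.
  rewrite ler_pM2r ?invr_gt0 ?subr_gt0// ler_wpM2l// gerBl.
  by rewrite exprn_ge0// ltW.
suff main a b : dyadic a -> dyadic b -> a < b ->
    `|G a - G b| <= chain_const gam * B * `|b - a| `^ gam.
  move=> a b [da db]; have [ab|ba|->] := ltgtP a b; first exact: main.
    by rewrite distrC [X in _ * X `^ _]distrC; exact: main.
  by rewrite !subrr normr0 powR0 ?mulr0// gt_eqF.
move=> da db ab; have a01 := dyadic_bounds da; have b01 := dyadic_bounds db.
(* The upper bound [2 ^- m] makes the truncations equal or adjacent; the lower bound [2 ^- m.+1]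
   turns powers of [r] back into a power of [b - a]. *)
have /exists_scale[m /andP[mlt mle]] : 0 < b - a <= 1 by lra.
have near : `|G (dytrunc m a) - G (dytrunc m b)| <= B * r ^+ m.
  have [|->|[i [im -> ->]]] := dytrunc_near a01 b01 (m := m); last exact: el; first by lra.
  by rewrite subrr normr0 mulr_ge0// exprn_ge0// ltW.
have Ga := far m a da; have Gb := far m b db.
have le1 : `|G a - G b| <= B * r ^+ m * (1 + 2 / (1 - r)).
  apply: le_trans (ler_distD (G (dytrunc m a)) _ _) _.
  rewrite [X in X + _]distrC.
  apply: le_trans (lerD Ga (ler_distD (G (dytrunc m b)) _ _)) _.
  apply: le_trans (lerD (lexx _) (lerD near Gb)) _.
  by rewrite le_eqVlt; apply/orP; left; apply/eqP; ring.
apply: le_trans le1 _; rewrite /chain_const -/r (mulrC _ B) -2!mulrA ler_wpM2l//.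
rewrite mulrC -mulrA ler_wpM2l//.
  by rewrite addr_ge0// divr_ge0// subr_ge0 ltW.
rewrite mulrC ler_pdivlMr// -exprSr -powR_exp2V ge0_ler_powR ?nnegrE ?(ltW g0)//.
by rewrite gtr0_norm ?subr_gt0// ltW.
Qed.

End dyadic.

Section dyadic_holder.
Context {R : realType} {n : nat}.
Implicit Types s t : 'rV[R]_n.

Definition box_const (gam : 'I_n -> R) : R := \prod_j chain_const (gam j).

Lemma box_const_ge0 (gam : 'I_n -> R) : (forall j, 0 < gam j) -> 0 <= box_const gam.
Proof. by move=> g0; apply: prodr_ge0 => j _; exact: chain_const_ge0. Qed.

Lemma box_dyadic_holder (gam : 'I_n -> R) (M : R) (f : 'rV[R]_n -> R) :
  (forall j, 0 < gam j) -> 0 <= M ->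
  (forall s t, (forall j, elementary (s ord0 j) (t ord0 j)) ->
    `|box t f s| <= M * prod_dist gam s t) ->
  forall s t, (forall j, dyadic (s ord0 j)) -> (forall j, dyadic (t ord0 j)) ->
    `|box t f s| <= box_const gam * M * prod_dist gam s t.
Proof.
move=> g0 M0 H s t ds dt.
apply: (box_upgrade (e := elementary) (D := fun a b => dyadic a /\ dyadic b)) => //.
- by move=> j; exact: chain_const_ge0.
- by move=> j G B B0; exact: chaining.
Qed.

End dyadic_holder.

(** * Suprema of countable families of random variables *)

Section dyadic_code.
Context {R : realType}.

(* The elementary interval of level [m] and index [i] has code [2 ^ m + i - 1]. *)
Definition level (h : nat) : nat := trunc_log 2 h.+1.
Definition lo (h : nat) : R := (h.+1 - 2 ^ level h)%:R / 2 ^+ level h.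
Definition hi (h : nat) : R := (h.+1 - 2 ^ level h).+1%:R / 2 ^+ level h.

Lemma levelP h : (2 ^ level h <= h.+1 < 2 ^ (level h).+1)%N.
Proof. exact: trunc_log_bounds. Qed.

Lemma elementary_code (a b : R) : elementary a b -> exists h, a = lo h /\ b = hi h.
Proof.
move=> [m [i [im -> ->]]]; exists (2 ^ m + i).-1.
have E : (2 ^ m + i).-1.+1 = (2 ^ m + i)%N by rewrite prednK// addn_gt0 expn_gt0.
have L : level (2 ^ m + i).-1 = m.
  by rewrite /level E; apply: trunc_log_eq => //; rewrite leq_addr expnS; lia.
by rewrite /lo /hi L E addKn.
Qed.

Lemma lo_hi_dyadic h : dyadic (lo h) /\ dyadic (hi h).
Proof.
have := levelP h; rewrite expnS => H.
by split; [exists (level h), (h.+1 - 2 ^ level h)%N|exists (level h), (h.+1 - 2 ^ level h).+1];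
  split => //; lia.
Qed.

Lemma hiBlo h : hi h - lo h = 2 ^- level h.
Proof. by rewrite /hi /lo -mulrBl -natrB// subSnn mul1r. Qed.

(** Level [m] has [2 ^ m] codes, each contributing [4 ^- m], so the sum over all levels is 2.
    Comparison with [4 / h.+1 ^ 2] gives the cruder 8 without grouping by level, the correction
    [4 / N.+1] being what the induction needs. *)
Lemma sum_level N : \sum_(h < N) ((2 ^- level h) ^+ 2 : R) <= 8.
Proof.
have le h : (2 ^- level h) ^+ 2 <= 4 / h.+1%:R ^+ 2 :> R.
  have -> : 4 / h.+1%:R ^+ 2 = (2 / h.+1%:R) ^+ 2 :> R by rewrite expr_div_n; congr (_ / _); ring.
  rewrite lerXn2r ?nnegrE ?invr_ge0 ?exprn_ge0 ?divr_ge0//.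
  rewrite ler_pdivlMr// mulrC ler_pdivrMr ?exp2_gt0// -exprS -natrX ler_nat.
  by have /andP[_ /ltnW] := levelP h.
case: N => [|N]; first by rewrite big_ord0.
suff H : \sum_(h < N.+1) ((2 ^- level h) ^+ 2 : R) <= 8 - 4 / N.+1%:R.
  by apply: le_trans H _; rewrite gerBl divr_ge0.
elim: N => [|N IH]; first by rewrite big_ord1 /level trunc_log1 expr0 invr1 expr1n; lra.
rewrite big_ord_recr /=; apply: le_trans (lerD IH (le N.+1)) _.
have x0 : 0 < N.+1%:R :> R by rewrite ltr0n.
rewrite -subr_ge0 -[N.+2%:R]natr1; move: (N.+1%:R) x0 => x x0.
rewrite (_ : _ - _ = 4 / (x * (x + 1) ^+ 2)); last by field; lra.
by rewrite divr_ge0// mulr_ge0 ?exprn_ge0 ?addr_ge0// ltW.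
Qed.

End dyadic_code.

Section measurability.
Context {R : realType} {d : measure_display} {T : measurableType d}.

Lemma measurable_expR_comp (f : T -> R) : measurable_fun [set: T] f ->
  measurable_fun [set: T] (fun w => expR (f w)).
Proof. exact: (measurableT_comp (@measurable_expR R)). Qed.

Lemma measurable_expeR_comp (f : T -> \bar R) : measurable_fun [set: T] f ->
  measurable_fun [set: T] (fun w => expeR (f w)).
Proof.
suff me : measurable_fun [set: \bar R] (@expeR R) by exact: (measurableT_comp me).
(* [maxe 0 x] takes the values of the exponential at both infinities. *)
rewrite (_ : expeR = fun x : \bar R =>
  if x \is a fin_num then (expR (fine x))%:E else maxe 0%E x); last first.
  by apply/funext => -[x| |] //=; rewrite ?maxey ?maxeNy.
apply: measurable_fun_ifT => //=.
- by apply: (measurable_fun_bool true); exact/emeasurable_fin_num.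
- exact/measurable_EFinP/measurableT_comp.
- exact: measurable_maxe.
Qed.

End measurability.

Section sup_family.
Context {R : realType} {n : nat} {d : measure_display} {T : measurableType d}.
Variable P : probability T R.

Lemma integral_sup_le (g : nat -> T -> R) (c : R) :
  (forall N, measurable_fun [set: T] (g N)) -> (forall N w, 0 <= g N w) ->
  (forall w, {homo g ^~ w : N N' / (N <= N')%N >-> N <= N'}) ->
  (forall N, (\int[P]_w (g N w)%:E <= c%:E)%E) ->
  (\int[P]_w ereal_sup (range (fun N => (g N w)%:E)) <= c%:E)%E.
Proof.
move=> mg g0 ndg gc.
have E w : ereal_sup (range (fun N => (g N w)%:E)) = limn (fun N => (g N w)%:E).
  by apply/esym/cvg_lim => //; apply: ereal_nondecreasing_cvgn => a b ab; rewrite lee_fin ndg.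
rewrite (eq_integral (fun w => limn (fun N => (g N w)%:E))); last by move=> w _; exact: E.
rewrite (@monotone_convergence _ _ _ P _ measurableT (fun N w => (g N w)%:E)).
- apply: lime_le; last by near=> N; exact: gc.
  apply: ereal_nondecreasing_is_cvgn => a b ab.
  apply: ge0_le_integral => //; rewrite ?lee_fin//.
  + by move=> w _; rewrite lee_fin.
  + exact/measurable_EFinP.
  + exact/measurable_EFinP.
  + by move=> w _; rewrite lee_fin ndg.
- by move=> N; exact/measurable_EFinP.
- by move=> N w _; rewrite lee_fin.
- by move=> w _ a b ab; rewrite lee_fin ndg.
Unshelve. all: by end_near.
Qed.

Lemma measurable_ereal_sup (g : nat -> T -> \bar R) :
  (forall N, measurable_fun [set: T] (g N)) ->
  measurable_fun [set: T] (fun w => ereal_sup (range (g ^~ w))).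
Proof.
move=> mg; have := measurable_fun_esups mg 0.
congr (measurable_fun _ _); apply/funext => w; congr ereal_sup.
by apply/seteqP; split => [_ [k _ <-]|_ [k _ <-]]; exists k.
Qed.

Lemma integral_lty_ae (f : T -> \bar R) : measurable_fun [set: T] f ->
  (forall w, (0 <= f w)%E) -> (\int[P]_w f w < +oo)%E ->
  {ae P, forall w, f w \is a fin_num}.
Proof.
move=> mf f0 fi; have /integrable_ae : P.-integrable [set: T] f.
  apply/integrableP; split => //; rewrite (eq_integral f)// => w _.
  by rewrite gee0_abs.
by move=> /(_ measurableT); apply: filterS => w; exact.
Qed.

Variable U : ('I_n -> nat) -> T -> R.
Hypothesis mU : forall h, measurable_fun [set: T] (U h).
Variables (B iota p0 : R).
Hypothesis p01 : 1 <= p0.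
Hypothesis momU : forall p, p0 <= p -> forall h,
  (\int[P]_w (U h w `^ p)%:E <=
   (B `^ p * p `^ (p * iota) * \prod_j (2 ^- level (h j)) ^+ 2)%:E)%E.

(** The index cubes grow with [N], so the supremum is a monotone limit; starting the maximum at 0
    keeps it nonnegative whatever [U] is. *)
Definition maxU N w : R :=
  \big[Num.max/0]_(h : {ffun 'I_n -> 'I_N}) U (fun j => h j) w.

Definition supU w : \bar R := ereal_sup (range (fun N => (maxU N w)%:E)).

Lemma maxU_ge0 N w : 0 <= maxU N w.
Proof. by rewrite /maxU; elim/big_rec: _ => // h x _ x0; rewrite le_max x0 orbT. Qed.

Lemma U_le_maxU N (h : 'I_n -> nat) w : (forall j, h j < N)%N -> U h w <= maxU N w.
Proof.
move=> hN; have -> : h = (fun j => [ffun j => Ordinal (hN j)] j) :> ('I_n -> nat).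
  by apply/funext => j; rewrite ffunE.
exact: (le_bigmax _ (fun h : {ffun 'I_n -> 'I_N} => U (fun j => h j) w)).
Qed.

Lemma maxU_nondecreasing w : {homo maxU ^~ w : N N' / (N <= N')%N >-> N <= N'}.
Proof.
move=> N N' NN'; apply: bigmax_le => [|h _]; first exact: maxU_ge0.
by apply: U_le_maxU => j; exact: leq_trans (ltn_ord _) NN'.
Qed.

Lemma U_le_supU h w : ((U h w)%:E <= supU w)%E.
Proof.
apply: le_trans (ereal_sup_ubound _) => /=; last first.
  by exists (\max_j h j).+1 => //.
by rewrite lee_fin; apply: U_le_maxU => j; rewrite ltnS leq_bigmax.
Qed.

Lemma measurable_maxU N : measurable_fun [set: T] (maxU N).
Proof.
rewrite /maxU; elim: (index_enum _) => [|h l IH].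
  by under eq_fun do rewrite big_nil; exact: measurable_cst.
by under eq_fun do rewrite big_cons; exact: measurable_maxr.
Qed.

Lemma measurable_supU : measurable_fun [set: T] supU.
Proof. by apply: measurable_ereal_sup => N; exact/measurable_EFinP/measurable_maxU. Qed.

Lemma supU_ge0 w : (0 <= supU w)%E.
Proof.
apply: le_trans (ereal_sup_ubound _) => /=; last by exists 0%N.
by rewrite lee_fin maxU_ge0.
Qed.

Lemma maxU_powR_le p N w : 0 < p ->
  maxU N w `^ p <= \sum_(h : {ffun 'I_n -> 'I_N}) U (fun j => h j) w `^ p.
Proof.
move=> pp; rewrite /maxU; elim: (index_enum _) => [|h l IH].
  by rewrite !big_nil powR0// gt_eqF.
rewrite !big_cons /Num.max; case: ifP => _.
  by apply: le_trans IH _; rewrite lerDr powR_ge0.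
by rewrite lerDl; apply: sumr_ge0 => *; rewrite powR_ge0.
Qed.

Lemma measurable_maxU_powR N p : measurable_fun [set: T] (fun w => maxU N w `^ p).
Proof. by apply: (measurableT_comp (measurable_powR p)); exact: measurable_maxU. Qed.

(** The maximum is replaced by the sum. The sum over [h] of a product over coordinates factors into
    [n] one-dimensional sums, each at most 8, so the bound does not depend on [N]. *)
Lemma maxU_moment p N : p0 <= p ->
  (\int[P]_w (maxU N w `^ p)%:E <= (B `^ p * p `^ (p * iota) * 8 ^+ n)%:E)%E.
Proof.
move=> pp; have p_gt0 : 0 < p by apply: lt_le_trans pp; apply: lt_le_trans p01.
apply: le_trans (_ : _ <= \int[P]_w
    (\sum_(h : {ffun 'I_n -> 'I_N}) (U (fun j => h j) w `^ p)%:E))%E _.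
  apply: ge0_le_integral => //.
  - by move=> w _; rewrite lee_fin powR_ge0.
  - by apply/measurable_EFinP; exact: measurable_maxU_powR.
  - apply: emeasurable_sum => h; apply/measurable_EFinP.
    exact: (measurableT_comp (measurable_powR p)).
  - by move=> w _; rewrite sumEFin lee_fin maxU_powR_le.
rewrite ge0_integral_sum//; last 2 first.
- by move=> h; apply/measurable_EFinP; exact: (measurableT_comp (measurable_powR p)).
- by move=> h w _; rewrite lee_fin powR_ge0.
apply: le_trans (lee_sum _ (fun h _ => momU pp _)) _.
rewrite sumEFin lee_fin -mulr_sumr ler_wpM2l ?mulr_ge0 ?powR_ge0//.
rewrite -(bigA_distr_bigA (fun (j : 'I_n) (i : 'I_N) => (2 ^- level i) ^+ 2)).
rewrite prodr_const card_ord lerXn2r ?nnegrE ?sum_level//.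
by apply: sumr_ge0 => i _; rewrite exprn_ge0// invr_ge0 exprn_ge0.
Qed.

Lemma supU_fin : {ae P, forall w, supU w \is a fin_num}.
Proof.
(* The powers of order [p0] have integrals bounded uniformly in [N], so their supremum [V] is finite
   almost surely; as [p0 >= 1], it bounds [supU] by [1 + V]. *)
pose V w := ereal_sup (range (fun N => (maxU N w `^ p0)%:E)).
have p0_gt0 : 0 < p0 by apply: lt_le_trans p01.
have mV : measurable_fun [set: T] V.
  by apply: measurable_ereal_sup => N; exact/measurable_EFinP/measurable_maxU_powR.
have : {ae P, forall w, V w \is a fin_num}.
  apply: integral_lty_ae => //.
    move=> w; apply: le_trans (ereal_sup_ubound _) => /=; last by exists 0%N.
    by rewrite lee_fin powR_ge0.
  apply: le_lt_trans (integral_sup_le _ _ _ (fun N => maxU_moment N (lexx p0))) _.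
  - by move=> N; exact: measurable_maxU_powR.
  - by move=> N w; exact: powR_ge0.
  - move=> w a b ab; rewrite ge0_ler_powR ?nnegrE ?maxU_ge0 ?(ltW p0_gt0)//.
    exact: maxU_nondecreasing.
  - exact: ltry.
apply: filterS => w Vfin; rewrite ge0_fin_numE ?supU_ge0//.
apply: le_lt_trans (_ : (1 + V w < +oo)%E); last first.
  by move: Vfin; case: (V w) => // r _; rewrite -EFinD ltry.
apply: ub_ereal_sup => _ [N _ <-].
apply: le_trans (leeD (lexx _) (ereal_sup_ubound _)) => /=; last by exists N.
rewrite -EFinD lee_fin; have [le1|gt1] := leP (maxU N w) 1.
  by apply: le_trans le1 _; rewrite lerDl powR_ge0.
rewrite -[leLHS]powRr1 ?maxU_ge0//; apply: le_trans (ler_powR (ltW gt1) p01) _.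
by rewrite lerDr.
Qed.

Lemma sum_geo_half (q : R) N : 0 <= q <= 2^-1 -> \sum_(k < N) q ^+ k <= 2.
Proof.
move=> /andP[q0 q1]; suff H : \sum_(k < N) q ^+ k <= 2 - 2 * 2^-1 ^+ N.
  by apply: le_trans H _; rewrite gerBl mulr_ge0// exprn_ge0// invr_ge0.
elim: N => [|N IH]; first by rewrite big_ord0 expr0 mulr1 subrr.
rewrite big_ord_recr /=; apply: le_trans (lerD IH (lexx _)) _.
have : q ^+ N <= 2^-1 ^+ N by rewrite lerXn2r ?nnegrE// invr_ge0.
by rewrite exprS; lra.
Qed.

(** The quotient [k ^ k / k!] is one term of the exponential series at [k]. *)
Lemma natpow_le_fact k : (k%:R ^+ k : R) <= expR 1 ^+ k * k`!%:R.
Proof.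
case: k => [|k]; first by rewrite !expr0 mul1r.
rewrite -ler_pdivrMr ?ltr0n ?fact_gt0// -expRM_natl.
have := @expR_ge1Dxn R k.+1%:R k (ler0n _ _); rewrite mulr1; apply: le_trans.
by rewrite lerDr.
Qed.

Lemma exp_coeff_sum_le (x : R) N : 0 <= x -> \sum_(k < N) x ^+ k / k`!%:R <= expR x.
Proof.
move=> x0; have := @nondecreasing_cvgn_le R (series (exp_coeff x)) _ (is_cvg_series_exp_coeff x) N.
rewrite /series /= big_mkord; apply.
apply: nondecreasing_series => k _; rewrite /exp_coeff /=.
by rewrite divr_ge0// exprn_ge0.
Qed.

Lemma expR_le_sup (x : R) : 0 <= x ->
  ((expR x)%:E <= ereal_sup (range (fun N : nat => (\sum_(k < N) x ^+ k / k`!%:R)%:E)))%E.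
Proof.
move=> x0; have H : (series (exp_coeff x)) @ \oo --> expR x.
  exact: is_cvg_series_exp_coeff.
have H' : EFin \o (series (exp_coeff x)) @ \oo --> (expR x)%:E.
  by apply: cvg_EFin => //; exact: nearW.
rewrite -(cvg_lim _ H')//; apply: lime_le.
  by apply/cvg_ex; exists (expR x)%:E.
near=> N; apply: ereal_sup_ubound; exists N => //=.
by rewrite /series /= big_mkord.
Unshelve. all: by end_near.
Qed.

Hypothesis iota_gt0 : 0 < iota.
Let kappa := iota^-1.

(** If [kappa * k] reaches [p0], the moment bound applies with [p * iota = k], which produces
    [k ^ k]. For the finitely many smaller [k], the power is at most 1 plus the power of order [p0].
    The right side adds both cases. *)
Lemma maxU_moment_nat k N :
  (\int[P]_w ((maxU N w `^ kappa) ^+ k)%:E <=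
   (1 + B `^ p0 * p0 `^ (p0 * iota) * 8 ^+ n
    + 8 ^+ n * (B `^ kappa * kappa) ^+ k * k%:R ^+ k)%:E)%E.
Proof.
have k0 : 0 < kappa by rewrite invr_gt0.
have E w : (maxU N w `^ kappa) ^+ k = maxU N w `^ (kappa * k%:R).
  by rewrite -powR_mulrn ?powR_ge0// -powRrM.
under eq_integral do rewrite E.
have Ap : 0 <= B `^ p0 * p0 `^ (p0 * iota) * 8 ^+ n by rewrite !mulr_ge0 ?powR_ge0 ?exprn_ge0.
have [ge|lt] := leP p0 (kappa * k%:R).
  apply: le_trans (maxU_moment N ge) _; rewrite lee_fin.
  have -> : kappa * k%:R * iota = k%:R by rewrite /kappa; field; rewrite gt_eqF.
  have kk0 : 0 <= kappa * k%:R by rewrite mulr_ge0// ltW.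
  rewrite [B `^ (kappa * _)]powRrM (powR_mulrn _ (powR_ge0 _ _)) (powR_mulrn _ kk0).
  rewrite exprMn exprMn.
  have -> : B `^ kappa ^+ k * (kappa ^+ k * k%:R ^+ k) * 8 ^+ n =
    8 ^+ n * (B `^ kappa ^+ k * kappa ^+ k) * k%:R ^+ k by ring.
  by rewrite lerDr addr_ge0.
apply: le_trans (_ : _ <= \int[P]_w (1%:E + (maxU N w `^ p0)%:E))%E _.
  apply: ge0_le_integral => //.
  - by move=> w _; rewrite lee_fin powR_ge0.
  - exact/measurable_EFinP/measurable_maxU_powR.
  - by apply: emeasurable_funD => //; exact/measurable_EFinP/measurable_maxU_powR.
  - move=> w _; rewrite -EFinD lee_fin; have [le1|gt1] := leP (maxU N w) 1.
      rewrite -[leLHS]addr0 lerD ?powR_ge0// -[leRHS](onepowR (kappa * k%:R)).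
      by rewrite ge0_ler_powR ?nnegrE ?maxU_ge0// mulr_ge0// ltW.
    by apply: le_trans (ler_powR (ltW gt1) (ltW lt)) _; rewrite lerDr.
rewrite ge0_integralD//; last 2 first.
- by move=> w _; rewrite lee_fin powR_ge0.
- exact/measurable_EFinP/measurable_maxU_powR.
rewrite integral_cst// (_ : (1 * P [set: T] = 1%:E)%E); last by rewrite mul1e; exact: probability_setT.
rewrite -addrA [X in (_ <= X)%E]EFinD; apply: le_trans (leeD (lexx _) (maxU_moment N (lexx p0))) _.
by rewrite -EFinD lee_fin lerD2l lerDl !mulr_ge0 ?exprn_ge0 ?mulr_ge0 ?powR_ge0 ?(ltW k0).
Qed.

(** In the exponential series, the part of the moments independent of [k] sums to a multiple of
    [expR b]. The part with [k ^ k / k!] is dominated by a geometric series whose ratio is at most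
    1/2 by the condition on [b], hence the factor 2. *)
Lemma maxU_exp_moment (b : R) N : 0 <= b -> b * (B `^ kappa * kappa * expR 1) <= 2^-1 ->
  (\int[P]_w (expR (b * maxU N w `^ kappa))%:E <=
   ((1 + B `^ p0 * p0 `^ (p0 * iota) * 8 ^+ n) * expR b + 8 ^+ n * 2)%:E)%E.
Proof.
move=> b0 bB; have k0 : 0 < kappa by rewrite invr_gt0.
set A := 1 + _; have A0 : 0 <= A by rewrite addr_ge0// !mulr_ge0 ?powR_ge0 ?exprn_ge0.
pose g K w := \sum_(k < K) (b * maxU N w `^ kappa) ^+ k / k`!%:R.
have x0 w : 0 <= b * maxU N w `^ kappa by rewrite mulr_ge0// powR_ge0.
have t0 k w : 0 <= (b * maxU N w `^ kappa) ^+ k / k`!%:R by rewrite divr_ge0 ?exprn_ge0.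
have mt k : measurable_fun [set: T] (fun w => (b * maxU N w `^ kappa) ^+ k / k`!%:R).
  apply: measurable_funM => //; apply: measurable_funX.
  by apply: measurable_funM => //; exact: measurable_maxU_powR.
have mg K : measurable_fun [set: T] (g K).
  by rewrite /g; apply: measurable_sum => k; exact: mt.
have gsup : (\int[P]_w ereal_sup (range (fun K => (g K w)%:E)) <= (A * expR b + 8 ^+ n * 2)%:E)%E.
  apply: integral_sup_le => //.
  - by move=> K w; apply: sumr_ge0 => k _; exact: t0.
  - move=> w a c ac; rewrite /g -!(big_mkord xpredT (fun k => (b * maxU N w `^ kappa) ^+ k / k`!%:R)).
    by rewrite [leRHS](big_cat_nat (leq0n a) ac)//= lerDl; apply: sumr_ge0 => k _; exact: t0.
  - move=> K; rewrite /g; under eq_integral do rewrite -sumEFin.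
    rewrite ge0_integral_sum//; last 2 first.
    + by move=> k; exact/measurable_EFinP/mt.
    + by move=> k w _; rewrite lee_fin t0.
    apply: (@le_trans _ _ (\sum_(k < K) (A * (b ^+ k / k`!%:R) + 8 ^+ n * (b * (B `^ kappa * kappa * expR 1)) ^+ k)%:E)%E).
      apply: lee_sum => k _.
      rewrite (eq_integral (fun w => (b ^+ k / k`!%:R)%:E * ((maxU N w `^ kappa) ^+ k)%:E)%E); last first.
        by move=> w _; rewrite -EFinM exprMn mulrAC.
      have bk : 0 <= b ^+ k / k`!%:R by rewrite divr_ge0 ?exprn_ge0.
      rewrite ge0_integralZl_EFin//; last 2 first.
      * by move=> w _; rewrite lee_fin exprn_ge0// powR_ge0.
      * by apply/measurable_EFinP/measurable_funX; exact: measurable_maxU_powR.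
      apply: le_trans (lee_wpmul2l _ (maxU_moment_nat k N)) _; first by rewrite lee_fin.
      rewrite -EFinM lee_fin -/A mulrDr [_ * A]mulrC lerD2l.
      have f0 : 0 < k`!%:R :> R by rewrite ltr0n fact_gt0.
      rewrite mulrCA mulrA [X in X <= _](_ : _ = 8 ^+ n * (b * (B `^ kappa * kappa)) ^+ k * (k%:R ^+ k / k`!%:R)); last first.
        by rewrite !exprMn; ring.
      rewrite [leRHS](_ : _ = 8 ^+ n * (b * (B `^ kappa * kappa)) ^+ k * expR 1 ^+ k); last first.
        by rewrite !exprMn; ring.
      rewrite ler_wpM2l//.
        by rewrite mulr_ge0 ?exprn_ge0// mulr_ge0// mulr_ge0 ?powR_ge0// ltW.
      by rewrite ler_pdivrMr// natpow_le_fact.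
    rewrite sumEFin lee_fin big_split /= -!mulr_sumr lerD//.
      by rewrite ler_wpM2l// exp_coeff_sum_le.
    rewrite ler_wpM2l ?exprn_ge0// sum_geo_half// bB andbT.
    by rewrite !mulr_ge0 ?powR_ge0 ?expR_ge0// ltW.
apply: le_trans gsup; apply: ge0_le_integral => //.
- by apply/measurable_EFinP/measurable_expR_comp; apply: measurable_funM => //; exact: measurable_maxU_powR.
- by apply: measurable_ereal_sup => K; exact/measurable_EFinP.
- by move=> w _; exact: expR_le_sup.
Qed.

(* The factor 2 leaves room to compare [supU] with one of the [maxU N]. *)
Lemma supU_exp_moment (b : R) : 0 <= b ->
  b * 2 `^ kappa * (B `^ kappa * kappa * expR 1) <= 2^-1 ->
  (\int[P]_w expeR (b%:E * poweR (supU w) kappa) < +oo)%E.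
Proof.
move=> b0 bB; have k0 : 0 < kappa by rewrite invr_gt0.
set b2 := b * 2 `^ kappa; have b20 : 0 <= b2 by rewrite mulr_ge0// powR_ge0.
pose W w := ereal_sup (range (fun N => (expR (b2 * maxU N w `^ kappa))%:E)).
have mexp N : measurable_fun [set: T] (fun w => expR (b2 * maxU N w `^ kappa)).
  by apply: measurable_expR_comp; apply: measurable_funM => //; exact: measurable_maxU_powR.
have WN w N : ((expR (b2 * maxU N w `^ kappa))%:E <= W w)%E.
  by apply: ereal_sup_ubound; exists N.
have : (\int[P]_w W w < +oo)%E.
  apply: le_lt_trans (integral_sup_le _ _ _ (fun N => maxU_exp_moment N b20 bB)) _ => //.
  - move=> w a c ac; rewrite ler_expR ler_wpM2l// ge0_ler_powR ?nnegrE ?maxU_ge0 ?(ltW k0)//.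
    exact: maxU_nondecreasing.
  - exact: ltry.
apply: le_lt_trans; apply: ae_ge0_le_integral => //.
- by move=> w _; exact: expeR_ge0.
- apply: measurable_expeR_comp.
  apply: emeasurable_funM => //.
  by apply: (measurableT_comp (measurable_poweR kappa)); exact: measurable_supU.
- by move=> w _; apply: le_trans (WN w 0%N); rewrite lee_fin expR_ge0.
- by apply: measurable_ereal_sup => N; exact/measurable_EFinP.
- apply: filterS supU_fin => w fin _.
  have [N HN] : exists N, (supU w <= (2 * maxU N w)%:E)%E.
    have [le0|gt0] := leP (supU w) 0%E.
      by exists 0%N; apply: le_trans le0 _; rewrite lee_fin mulr_ge0// maxU_ge0.
    have : (((fine (supU w)) / 2)%:E < supU w)%E.
      rewrite -[X in (_ < X)%E]fineK// lte_fin ltr_pdivrMr// ltr_pMr ?ltr1n//.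
      by rewrite fine_gt0// gt0 -ge0_fin_numE// ltW.
    move=> /ereal_sup_gt[_ [N _ <-]]; rewrite lte_fin ltr_pdivrMr// => /ltW h.
    by exists N; rewrite -[X in (X <= _)%E]fineK// lee_fin mulrC.
  apply: le_trans (WN w N); rewrite -[X in poweR X _]fineK// poweR_EFin -EFinM /= lee_fin ler_expR.
  rewrite /b2 -mulrA ler_wpM2l// -powRM ?maxU_ge0//.
  rewrite ge0_ler_powR ?nnegrE ?(ltW k0) ?mulr_ge0 ?maxU_ge0 ?fine_ge0 ?supU_ge0//.
  by rewrite -lee_fin fineK.
Qed.

End sup_family.

(** * Limits along dyadic truncations *)

Section dyadic_limits.
Context {R : realType} {n : nat}.
Implicit Types (s t x y : 'rV[R]_n) (f g : 'rV[R]_n -> R) (gam : 'I_n -> R).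

Definition trunc_pt (N : nat) x : 'rV[R]_n := map_mx (dytrunc N) x.

Lemma trunc_ptE N x j : trunc_pt N x ord0 j = dytrunc N (x ord0 j).
Proof. by rewrite mxE. Qed.

Lemma dyadic_trunc_pt N x : cube x -> forall j, dyadic (trunc_pt N x ord0 j).
Proof. by move=> cx j; rewrite trunc_ptE; apply: dyadic_dytrunc; exact: cx. Qed.

Lemma dyadic_cube x : (forall j, dyadic (x ord0 j)) -> cube x.
Proof. by move=> dx j; have := dyadic_bounds (dx j). Qed.

Lemma cube_trunc_pt N x : cube x -> cube (trunc_pt N x).
Proof. by move=> cx; apply: dyadic_cube; exact: dyadic_trunc_pt. Qed.

Lemma dist_dytrunc N (u : R) : 0 <= u -> `|u - dytrunc N u| <= 2 ^- N.
Proof.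
by move=> u0; have /andP[? ?] := dytrunc_itv N u0; rewrite ler_norml; apply/andP; split; lra.
Qed.

Lemma exp2V_le (N N' : nat) : (N <= N')%N -> 2 ^- N' <= 2 ^- N :> R.
Proof.
by move=> NN'; rewrite lef_pV2 ?posrE ?exprn_gt0// ler_eXn2l ?ltr1n.
Qed.

Lemma cvg_exp2V : (fun N : nat => 2 ^- N : R) @ \oo --> 0.
Proof.
under eq_fun do rewrite -exprVn; apply: cvg_expr.
by rewrite ger0_norm ?invr_ge0// invf_lt1// ltr1n.
Qed.

Lemma cvg_dytrunc (u : R) : 0 <= u -> dytrunc N u @[N --> \oo] --> u.
Proof.
move=> u0; apply/cvgrPdist_le => e e0.
have /cvgrPdist_le/(_ e e0) := cvg_exp2V; apply: filterS => N.
rewrite sub0r normrN ger0_norm ?invr_ge0 ?exprn_ge0//.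
exact: le_trans (dist_dytrunc _ u0).
Qed.

(** The exponent may have any sign, since [alpha - eps] may be negative in the Hoelder constant;
    therefore the limit has to stay away from 0. *)
Lemma cvg_powR_base (a : R) (F : set_system nat) (u : nat -> R) (l : R) :
  Filter F -> 0 < l -> u N @[N --> F] --> l -> u N `^ a @[N --> F] --> l `^ a.
Proof.
move=> FF l0 ul; have H : {for l, continuous (fun x : R => x `^ a)}.
  apply: differentiable_continuous; apply/derivable1_diffP.
  by apply: derivable_powR; rewrite in_itv /= andbT.
exact: (@continuous_cvg _ _ _ F FF u (fun x : R => x `^ a) l H ul).
Qed.

Lemma cvg_prod_dist gam s t : cube s -> cube t -> apart s t ->
  prod_dist gam (trunc_pt N s) (trunc_pt N t) @[N --> \oo] --> prod_dist gam s t.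
Proof.
move=> cs ct st; apply: (cvg_big mul_continuous) => j _.
apply: cvg_powR_base; first by rewrite normr_gt0 subr_eq0 eq_sym.
under eq_fun do rewrite !trunc_ptE; apply: cvg_norm; apply: cvgB; apply: cvg_dytrunc.
  by have /andP[] := ct j.
by have /andP[] := cs j.
Qed.

Lemma apart_trunc_pt s t : cube s -> cube t -> apart s t ->
  \forall N \near \oo, apart (trunc_pt N s) (trunc_pt N t).
Proof.
move=> cs ct st; apply: filter_forall => j.
have d0 : 0 < `|s ord0 j - t ord0 j| by rewrite normr_gt0 subr_eq0.
have /andP[s0 _] := cs j; have /andP[t0 _] := ct j.
have H : `|dytrunc N (s ord0 j) - dytrunc N (t ord0 j)| @[N --> \oo] -->
    `|s ord0 j - t ord0 j| by apply: cvg_norm; apply: cvgB; exact: cvg_dytrunc.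
have [N0 _ HN] := cvgr_gt _ H _ d0; exists N0 => // N /= /HN /=.
by rewrite !trunc_ptE normr_gt0 subr_eq0.
Qed.

Lemma cvg_exp2V_powR (a : R) : 0 < a -> (2 ^- N : R) `^ a @[N --> \oo] --> 0.
Proof.
move=> a0; under eq_fun do rewrite powR_exp2V.
apply: cvg_expr; rewrite ger0_norm ?powR_ge0//.
by rewrite -[X in _ < X](onepowR a) gt0_ltr_powR ?nnegrE ?invr_ge0// invf_lt1// ltr1n.
Qed.

Lemma modulus_cvg0 gam : (forall j, 0 < gam j) ->
  \sum_j (2 ^- N : R) `^ gam j @[N --> \oo] --> 0.
Proof.
move=> g0; rewrite [X in _ --> X](_ : _ = \sum_(j < n) (0 : R)); last by rewrite big1.
by apply: (cvg_big add_continuous) => j _; exact: cvg_exp2V_powR.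
Qed.

Lemma boxl_cvg (l : seq 'I_n) (f_ : nat -> 'rV[R]_n -> R) g t x :
  (forall y, cube y -> f_ N y @[N --> \oo] --> g y) -> cube t -> cube x ->
  boxl l t (f_ N) x @[N --> \oo] --> boxl l t g x.
Proof.
move=> fg ct; elim: l x => [|k l IH] x cx; first exact: fg.
rewrite /= diffopE; under eq_fun do rewrite diffopE.
by apply: cvgB; apply: IH => //; apply: cube_upd => //; exact: ct.
Qed.

(** Truncating both corners amounts to truncating the argument of the function, by [box_map]. The
    corners then stay fixed, and pointwise convergence on the cube is enough. *)
Lemma box_trunc_cvg f g s t :
  (forall y, cube y -> reduct f (trunc_pt N y) @[N --> \oo] --> g y) ->
  cube s -> cube t ->
  box (trunc_pt N t) f (trunc_pt N s) @[N --> \oo] --> box t g s.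
Proof.
move=> fg cs ct; rewrite boxE.
have -> : (fun N => box (trunc_pt N t) f (trunc_pt N s)) =
    (fun N => boxl (index_enum 'I_n) t (reduct f \o trunc_pt N) s).
  by apply/funext => N; rewrite -boxE box_map box_reduct.
exact: boxl_cvg.
Qed.

Definition box_holder (D : R -> Prop) gam (c : R) f :=
  forall s t, (forall j, D (s ord0 j)) -> (forall j, D (t ord0 j)) -> apart s t ->
    `|box t f s| <= c * prod_dist gam s t.

Lemma reduct_trunc_cauchy gam c f : (forall j, 0 < gam j) -> 0 <= c ->
  box_holder dyadic gam c f ->
  forall x, cube x -> cvg (reduct f (trunc_pt N x) @[N --> \oo]).
Proof.
move=> g0 c0 H x cx; apply/cauchy_cvgP/cauchy_exP => e e0.
have : c * \sum_j (2 ^- N : R) `^ gam j @[N --> \oo] --> c * 0.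
  by apply: cvgM; [exact: cvg_cst|exact: modulus_cvg0].
rewrite mulr0.
move=> /cvgrPdist_lt/(_ e e0)[N _ HN]; exists (reduct f (trunc_pt N x)).
exists N => // N' /= NN'; rewrite /ball /=.
apply: le_lt_trans (HN N (leqnn N)); rewrite sub0r normrN [leRHS]ger0_norm; last first.
  by rewrite mulr_ge0// sumr_ge0// => j _; rewrite powR_ge0.
apply: le_trans (reduct_holder (D := dyadic) dyadic0 (@dyadic_bounds R) g0 c0 H _ _) _.
- exact: dyadic_trunc_pt.
- exact: dyadic_trunc_pt.
rewrite ler_wpM2l// ler_sum// => j _.
rewrite ge0_ler_powR ?nnegrE ?(ltW (g0 j)) ?invr_ge0 ?exprn_ge0// !trunc_ptE.
have /andP[x0 _] := cx j.
have /andP[? ?] := dytrunc_itv N x0; have /andP[? ?] := dytrunc_itv N' x0.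
by have := exp2V_le NN'; rewrite ler_norml => ?; apply/andP; split; lra.
Qed.

Lemma reduct_trunc_cvg gam c f : (forall j, 0 < gam j) -> 0 <= c ->
  box_holder (fun u => 0 <= u <= 1) gam c f ->
  forall x, cube x -> reduct f (trunc_pt N x) @[N --> \oo] --> reduct f x.
Proof.
move=> g0 c0 H x cx; apply/cvgrPdist_lt => e e0.
have : c * \sum_j (2 ^- N : R) `^ gam j @[N --> \oo] --> c * 0.
  by apply: cvgM; [exact: cvg_cst|exact: modulus_cvg0].
rewrite mulr0.
move=> /cvgrPdist_lt/(_ e e0); apply: filterS => N; apply: le_lt_trans.
rewrite sub0r normrN [leRHS]ger0_norm; last first.
  by rewrite mulr_ge0// sumr_ge0// => j _; rewrite powR_ge0.
apply: le_trans (reduct_holder (D := fun u => 0 <= u <= 1) _ _ g0 c0 H _ _) _ => //.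
- by rewrite lexx ler01.
- exact: cube_trunc_pt.
rewrite ler_wpM2l// ler_sum// => j _.
rewrite ge0_ler_powR ?nnegrE ?(ltW (g0 j)) ?invr_ge0 ?exprn_ge0// !trunc_ptE distrC.
by apply: dist_dytrunc; have /andP[] := cx j.
Qed.

Lemma box_holder_limit gam c f g :
  (forall y, cube y -> reduct f (trunc_pt N y) @[N --> \oo] --> g y) ->
  box_holder dyadic gam c f -> box_holder (fun u => 0 <= u <= 1) gam c g.
Proof.
move=> fg H s t cs ct st.
have b : `|box (trunc_pt N t) f (trunc_pt N s)| @[N --> \oo] --> `|box t g s|.
  by apply: cvg_norm; exact: box_trunc_cvg.
have p : c * prod_dist gam (trunc_pt N s) (trunc_pt N t) @[N --> \oo] -->
    c * prod_dist gam s t by apply: cvgM; [exact: cvg_cst|exact: cvg_prod_dist].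
apply: ler_cvg_to b p _; apply: filterS (apart_trunc_pt cs ct st) => N aN.
by apply: H => //; exact: dyadic_trunc_pt.
Qed.

End dyadic_limits.

(** * Elementary increments of a random field *)

Section fields.
Context {R : realType} {n : nat} {d : measure_display} {T : measurableType d}.
Variable P : probability T R.
Implicit Types (X Y : 'rV[R]_n -> T -> R) (s t x : 'rV[R]_n).

Lemma incrementE X t s w : increment X t s w = boxl (index_enum 'I_n) t (X ^~ w) s.
Proof. by rewrite /increment boxE. Qed.

Lemma measurable_increment X t s : random_field X -> cube s -> cube t ->
  measurable_fun [set: T] (increment X t s).
Proof.
move=> mX cs ct; rewrite (_ : increment X t s = fun w => boxl (index_enum 'I_n) t (X ^~ w) s); last first.
  by apply/funext => w; exact: incrementE.
elim: (index_enum _) s cs => [|k l IH] s cs; first exact: mX.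
under eq_fun do rewrite /= diffopE; apply: measurable_funB; apply: IH => //.
by apply: cube_upd => //; exact: ct.
Qed.

Lemma measurable_eq_set (f g : T -> R) : measurable_fun [set: T] f ->
  measurable_fun [set: T] g -> measurable [set w | f w = g w].
Proof.
move=> mf mg; rewrite (_ : [set w | _] = [set: T] `&` (fun w => f w == g w) @^-1` [set true]).
  exact: measurable_fun_eqr.
by apply/seteqP; split => w /= [] => [->|_ /eqP]; rewrite ?eqxx.
Qed.

Lemma modification_ae X Y t : random_field X -> modification P X Y -> cube t ->
  {ae P, forall w, Y t w = X t w}.
Proof.
move=> mX [mY XY] ct; have mE := measurable_eq_set (mY t ct) (mX t ct).
exists (~` [set w | Y t w = X t w]); split => //; first exact: measurableC.
by rewrite [LHS]probability_setC// [X in (_ - X)%E]XY// subee.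
Qed.

Lemma increment_ae X Y t s : random_field X -> modification P X Y -> cube s -> cube t ->
  {ae P, forall w, increment Y t s w = increment X t s w}.
Proof.
move=> mX XY cs ct.
suff : {ae P, forall w, boxl (index_enum 'I_n) t (Y ^~ w) s = boxl (index_enum 'I_n) t (X ^~ w) s}.
  by apply: filterS => w; rewrite !incrementE.
elim: (index_enum _) s cs => [|k l IH] s cs; first exact: modification_ae.
have H1 := IH s cs; have H2 : cube (upd k (t ord0 k) s) by apply: cube_upd => //; exact: ct.
by apply: filterS2 H1 (IH _ H2) => w e1 e2; rewrite /= !diffopE e1 e2.
Qed.

Lemma expectation_increment_ae (h : R -> R) X Y t s :
  measurable_fun [set: R] h -> random_field X -> modification P X Y -> cube s -> cube t ->
  ('E_P[fun w => h (increment Y t s w)] = 'E_P[fun w => h (increment X t s w)])%E.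
Proof.
move=> mh mX XY cs ct; have mY := XY.1.
rewrite unlock; apply: ae_eq_integral => //.
- by apply/measurable_EFinP; apply: (measurableT_comp mh); exact: measurable_increment.
- by apply/measurable_EFinP; apply: (measurableT_comp mh); exact: measurable_increment.
- by apply: filterS (increment_ae mX XY cs ct) => w ->.
Qed.

Lemma measurable_abs_sqr : measurable_fun [set: R] (fun x : R => `|x| ^+ 2).
Proof. exact: measurable_funX. Qed.

Lemma measurable_abs_powR p : measurable_fun [set: R] (fun x : R => `|x| `^ p).
Proof. exact: (measurableT_comp (measurable_powR p)). Qed.

Lemma dX_modification X Y t s : random_field X -> modification P X Y ->
  cube s -> cube t -> dX P Y t s = dX P X t s.
Proof.
by move=> mX XY cs ct; rewrite /dX (expectation_increment_ae measurable_abs_sqr mX XY cs ct).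
Qed.

Lemma moment_growth_modification C0 iota X Y : random_field X -> modification P X Y ->
  moment_growth P C0 iota X -> moment_growth P C0 iota Y.
Proof.
move=> mX XY H p p1 s t cs ct; rewrite (dX_modification mX XY cs ct).
by rewrite (expectation_increment_ae (measurable_abs_powR p) mX XY cs ct) H.
Qed.

Lemma dX_bound_modification alpha eps C X Y : random_field X -> modification P X Y ->
  dX_bound P alpha eps C X -> dX_bound P alpha eps C Y.
Proof. by move=> mX XY H s t cs ct st; rewrite (dX_modification mX XY cs ct) H. Qed.

Lemma square_integrable_modification X Y : random_field X -> modification P X Y ->
  square_integrable_increments P X -> square_integrable_increments P Y.
Proof.
by move=> mX XY H s t cs ct; rewrite (expectation_increment_ae measurable_abs_sqr mX XY cs ct) H.
Qed.

Lemma dX_ge0 X t s : 0 <= dX P X t s.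
Proof. exact: sqrtr_ge0. Qed.

End fields.

(** * Moments of the scaled elementary increments *)

Section elementary_family.
Context {R : realType} {n : nat} {d : measure_display} {T : measurableType d}.
Variable P : probability T R.
Variables (X : 'rV[R]_n -> T -> R) (C0 iota K : R) (alpha eps : 'I_n -> R).
Hypotheses (C00 : 0 < C0) (K0 : 0 < K).
Hypotheses (eps0 : forall j, 0 < eps j) (eps_lt : forall j, eps j < alpha j).
Hypotheses (mX : random_field X) (momX : moment_growth P C0 iota X).
Hypothesis dXK : dX_bound P alpha eps K X.

Let gam j := alpha j - eps j.

Let gam_gt0 j : 0 < gam j.
Proof. by rewrite subr_gt0. Qed.

Definition lo_pt (h : 'I_n -> nat) : 'rV[R]_n := \row_j lo (h j).
Definition hi_pt (h : 'I_n -> nat) : 'rV[R]_n := \row_j hi (h j).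

Lemma cube_lo_pt h : cube (lo_pt h).
Proof. by apply: dyadic_cube => j; rewrite mxE; exact: (lo_hi_dyadic _).1. Qed.

Lemma cube_hi_pt h : cube (hi_pt h).
Proof. by apply: dyadic_cube => j; rewrite mxE; exact: (lo_hi_dyadic _).2. Qed.

Lemma hiBlo_pt h j : `|hi_pt h ord0 j - lo_pt h ord0 j| = 2 ^- level (h j).
Proof. by rewrite !mxE hiBlo ger0_norm// invr_ge0 exprn_ge0. Qed.

Lemma apart_lo_hi h : apart (lo_pt h) (hi_pt h).
Proof.
move=> j; rewrite eq_sym -subr_eq0 -normr_eq0 hiBlo_pt.
by rewrite gt_eqF// invr_gt0 exprn_gt0.
Qed.

Lemma prod_dist_lo_hi (e : 'I_n -> R) h :
  prod_dist e (lo_pt h) (hi_pt h) = \prod_j (2 ^- level (h j)) `^ e j.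
Proof. by apply: eq_bigr => j _; rewrite hiBlo_pt. Qed.

Definition scaled (h : 'I_n -> nat) (w : T) : R :=
  `|increment X (hi_pt h) (lo_pt h) w| / prod_dist gam (lo_pt h) (hi_pt h).

Lemma measurable_scaled h : measurable_fun [set: T] (scaled h).
Proof.
apply: measurable_funM => //; apply: measurableT_comp => //.
by apply: measurable_increment => //; [exact: cube_lo_pt|exact: cube_hi_pt].
Qed.

(** Each [4 / eps j] is below it, so the spare exponent [eps j / 2] becomes at least 2 in a moment
    of this order; the sum serves as an upper bound for the maximum. *)
Definition moment_threshold : R := 1 + \sum_j 4 / eps j.

Lemma moment_threshold_ge1 : 1 <= moment_threshold.
Proof. by rewrite lerDl sumr_ge0// => j _; rewrite divr_ge0// ltW. Qed.

Lemma moment_thresholdP p j : moment_threshold <= p -> 2 <= eps j / 2 * p.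
Proof.
move=> hp; have : 4 / eps j <= p.
  apply: le_trans hp; rewrite /moment_threshold (bigD1 j)//= addrCA lerDl addr_ge0//.
  by rewrite sumr_ge0// => i _; rewrite divr_ge0// ltW.
by rewrite ler_pdivrMr// => ?; lra.
Qed.

Definition scale_const : R := C0 * Num.sqrt K.

Lemma scaled_moment p : moment_threshold <= p -> forall h,
  (\int[P]_w (scaled h w `^ p)%:E <=
   (scale_const `^ p * p `^ (p * iota) * \prod_j (2 ^- level (h j)) ^+ 2)%:E)%E.
Proof.
move=> hp h; have p1 : 1 <= p := le_trans moment_threshold_ge1 hp.
have p0 : 0 <= p by apply: le_trans p1.
set s := lo_pt h; set t := hi_pt h; set q := prod_dist gam s t.
have st : apart s t := apart_lo_hi h.
have q0 : 0 < q by exact: prod_dist_gt0.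
have cs : cube s := cube_lo_pt h; have ct : cube t := cube_hi_pt h.
(* [q] is the Hoelder scale to be divided out and [rho] the spare regularity: the bound on [dX] has
   exponent [alpha - eps / 2], that is [gam + eps / 2]. *)
pose rho := \prod_j (2 ^- level (h j) : R) `^ (eps j / 2).
have rho0 : 0 <= rho by apply: prodr_ge0 => j _; rewrite powR_ge0.
have dle : dX P X t s <= Num.sqrt K * (q * rho).
  rewrite -(ler_pXn2r (n := 2)) ?nnegrE ?dX_ge0 ?mulr_ge0 ?sqrtr_ge0 ?(ltW q0)//.
  apply: le_trans (dXK cs ct st) _; rewrite exprMn sqr_sqrtr ?(ltW K0)// ler_wpM2l ?(ltW K0)//.
  rewrite /q /rho !prod_dist_lo_hi -big_split /= expr2 -big_split /= le_eqVlt; apply/orP; left; apply/eqP.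
  apply: eq_bigr => j _; have l0 : (2 ^- level (h j) : R) != 0.
    by rewrite gt_eqF// invr_gt0 exprn_gt0.
  rewrite -!powRD ?l0 ?implybT//; congr (_ `^ _); rewrite /gam; lra.
have rhop : rho `^ p <= \prod_j (2 ^- level (h j)) ^+ 2.
  (* The comparison is made factor by factor; nonnegativity is carried along because powers
     distribute only over nonnegative factors. *)
  apply: (proj2 (big_ind2 (fun x y : R => 0 <= x /\ x `^ p <= y) _ _ _)) => //.
  - by rewrite onepowR.
  - move=> x1 y1 x2 y2 [x10 xy1] [x20 xy2]; rewrite mulr_ge0// powRM//; split => //.
    by rewrite ler_pM// powR_ge0.
  - move=> j _; rewrite powR_ge0; split => //; rewrite -powRrM -[leRHS]powR_mulrn ?invr_ge0 ?exprn_ge0//.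
    have l1 : 0 < (2 ^- level (h j) : R) <= 1.
      by rewrite invr_gt0 exprn_gt0// invf_le1 ?exprn_gt0// exprn_ege1// ler1n.
    by rewrite ger_powR// moment_thresholdP.
have qp0 : 0 < q `^ p by rewrite powR_gt0.
have E w : scaled h w `^ p = (q `^ p)^-1 * `|increment X t s w| `^ p.
  rewrite /scaled -/s -/t -/q powRM ?invr_ge0 ?(ltW q0)// mulrC; congr (_ * _).
  by rewrite -powR_inv1 ?(ltW q0)// -powRrM mulrC powRrM powR_inv1 ?powR_ge0.
under eq_integral do rewrite E EFinM.
have m : measurable_fun [set: T] (fun w => (`|increment X t s w| `^ p)%:E).
  apply/measurable_EFinP; apply: (measurableT_comp (measurable_abs_powR p)).
  exact: measurable_increment.
rewrite ge0_integralZl_EFin//; last by rewrite invr_ge0 ltW.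
have := momX p1 cs ct; rewrite unlock => M.
apply: le_trans (lee_wpmul2l _ M) _; first by rewrite lee_fin invr_ge0 ltW.
rewrite -EFinM lee_fin /scale_const powRM ?sqrtr_ge0 ?(ltW C00)//.
have dp : dX P X t s `^ p <= Num.sqrt K `^ p * q `^ p * rho `^ p.
  rewrite -mulrA -powRM ?(ltW q0)// -powRM ?sqrtr_ge0 ?mulr_ge0 ?(ltW q0)//.
  by rewrite ge0_ler_powR ?nnegrE ?dX_ge0 ?mulr_ge0 ?sqrtr_ge0 ?(ltW q0).
rewrite [leLHS]mulrC (ler_pdivrMr _ _ qp0).
apply: le_trans (_ : _ <= C0 `^ p * p `^ (p * iota) * (Num.sqrt K `^ p * q `^ p * rho `^ p)) _.
  by rewrite ler_wpM2l ?mulr_ge0 ?powR_ge0.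
have perm (a b c e f : R) : a * b * (c * e * f) = a * c * b * e * f by ring.
rewrite perm [leRHS]mulrAC.
by rewrite ler_wpM2l ?mulr_ge0 ?powR_ge0.
Qed.

Definition holder_sup : T -> \bar R := supU scaled.

Lemma measurable_holder_sup : measurable_fun [set: T] holder_sup.
Proof. exact: (measurable_supU measurable_scaled). Qed.

Lemma holder_sup_fin : {ae P, forall w, holder_sup w \is a fin_num}.
Proof.
apply: (supU_fin measurable_scaled (B := scale_const) (iota := iota) moment_threshold_ge1).
exact: scaled_moment.
Qed.

Lemma holder_sup_ge0 w : (0 <= holder_sup w)%E.
Proof. exact: supU_ge0. Qed.

Lemma holder_sup_dyadic w : holder_sup w \is a fin_num ->
  box_holder dyadic gam (box_const gam * fine (holder_sup w)) (X ^~ w).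
Proof.
move=> fin s t ds dt _; apply: box_dyadic_holder => //.
  by rewrite fine_ge0// holder_sup_ge0.
move=> {ds dt}s {}t st; have /choice[h hst] : forall j, exists h, s ord0 j = lo h /\ t ord0 j = hi h.
  by move=> j; exact: elementary_code.
have -> : s = lo_pt h by apply: row_ext => j; rewrite mxE (hst j).1.
have -> : t = hi_pt h by apply: row_ext => j; rewrite mxE (hst j).2.
rewrite -ler_pdivrMr ?prod_dist_gt0//; last exact: apart_lo_hi.
by rewrite -lee_fin fineK//; exact: U_le_supU.
Qed.

End elementary_family.

(** * The regular modification *)

Section exponents.
Context {R : realType} {n : nat}.
Implicit Types (alpha eps : 'I_n -> R) (s t : 'rV[R]_n).

Lemma cube_dist_le1 s t j : cube s -> cube t -> `|t ord0 j - s ord0 j| <= 1.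
Proof. by move=> cs ct; have := cs j; have := ct j; rewrite ler_norml; lra. Qed.

Lemma prod_dist_le (e e' : 'I_n -> R) s t : cube s -> cube t -> apart s t ->
  (forall j, e' j <= e j) -> prod_dist e s t <= prod_dist e' s t.
Proof.
move=> cs ct st ee'; apply: ler_prod => j _; rewrite powR_ge0 /=.
by rewrite ger_powR// cube_dist_le1// normr_gt0 subr_eq0 eq_sym st.
Qed.

(* Shrinking [eps] makes the exponents [alpha - eps] positive. *)
Definition small_eps alpha eps (j : 'I_n) : R := Num.min (eps j) (alpha j / 2).

Lemma small_epsP alpha eps : (forall j, 0 < alpha j) -> (forall j, 0 < eps j) ->
  forall j, [/\ 0 < small_eps alpha eps j, small_eps alpha eps j < alpha j
              & small_eps alpha eps j <= eps j].
Proof.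
move=> a0 e0 j; have := a0 j; have := e0 j; rewrite /small_eps => ? ?.
by rewrite lt_min gt_min ge_min lexx; split => //; lra.
Qed.

End exponents.

Section regular_modification.
Context {R : realType} {n : nat} {d : measure_display} {T : measurableType d}.
Variable P : probability T R.
Variable X : 'rV[R]_n -> T -> R.
Implicit Types (s t x : 'rV[R]_n).

(** The upper limit exists for every [w] and is measurable, and it is the limit wherever the
    sequence converges; [fine] gives 0 at infinite values. *)
Definition reduct_lim t (w : T) : R :=
  fine (limn_esup (fun N => (reduct (X ^~ w) (trunc_pt N t))%:E)).

(** Only the part with the increments of [X] is exchanged for its extension from dyadic points. The
    remaining part is kept, so that the result can agree with [X] and not merely with [reduct X]. *)
Definition regular t (w : T) : R := X t w - (reduct (X ^~ w) t - reduct_lim t w).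

Lemma reduct_limP t w : cvg (reduct (X ^~ w) (trunc_pt N t) @[N --> \oo]) ->
  reduct (X ^~ w) (trunc_pt N t) @[N --> \oo] --> reduct_lim t w.
Proof.
move=> /cvg_ex[l /= ul]; rewrite /reduct_lim.
have : (reduct (X ^~ w) (trunc_pt N t))%:E @[N --> \oo] --> l%:E.
  by apply: cvg_EFin => //; exact: nearW.
by move=> /cvg_limn_einf_sup[_ ->].
Qed.

Hypothesis mX : random_field X.

Lemma measurable_reduct t : cube t -> measurable_fun [set: T] (fun w => reduct (X ^~ w) t).
Proof. by move=> ct; apply: (measurable_increment mX ct); exact: cube0. Qed.

Lemma measurable_reduct_lim t : cube t -> measurable_fun [set: T] (reduct_lim t).
Proof.
move=> ct; apply: (measurableT_comp (fine_measurable measurableT)).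
apply: measurable_fun_limn_esup => N; apply/measurable_EFinP.
by apply: measurable_reduct; exact: cube_trunc_pt.
Qed.

Lemma random_field_regular : random_field regular.
Proof.
move=> t ct; apply: measurable_funB; first exact: mX.
by apply: measurable_funB; [exact: measurable_reduct|exact: measurable_reduct_lim].
Qed.

Lemma box_regular s t w : box t (regular ^~ w) s = box t (reduct_lim ^~ w) s.
Proof. by rewrite /regular !boxB box_reduct; ring. Qed.

Lemma box_holder_regular gam c w : (forall j, 0 < gam j) -> 0 <= c ->
  box_holder dyadic gam c (X ^~ w) ->
  box_holder (fun u => 0 <= u <= 1) gam c (regular ^~ w).
Proof.
move=> g0 c0 H s t cs ct st; rewrite box_regular.
apply: (box_holder_limit _ H) => // y cy; apply: reduct_limP.
exact: reduct_trunc_cauchy H _ cy.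
Qed.

Variables (C0 iota K : R) (alpha : 'I_n -> R).
Hypotheses (C00 : 0 < C0) (K0 : 0 < K) (alpha0 : forall j, 0 < alpha j).
Hypotheses (momX : moment_growth P C0 iota X) (dXK : dX_bound P alpha alpha K X).

(** The first moment is bounded by [dX]. Taking [eps = alpha] leaves the positive exponents
    [alpha j], so every factor except the one in direction [k] is at most 1: one short side suffices
    for a small mean. *)
Lemma mean_increment_le s t k (r : R) : cube s -> cube t -> 0 <= r ->
  `|t ord0 k - s ord0 k| <= r ->
  (\int[P]_w `|increment X t s w|%:E <= (C0 * Num.sqrt (K * r `^ alpha k))%:E)%E.
Proof.
move=> cs ct r0 tsr; have [st|] := pselect (apart s t); last first.
  move=> /existsNP[j /negP]; rewrite negbK => /eqP stj.
  rewrite (eq_integral (cst 0%E)).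
    by rewrite integral0 lee_fin mulr_ge0 ?sqrtr_ge0// ltW.
  by move=> w _; rewrite /increment (box_eq0 _ stj) normr0.
have := momX (lexx 1) cs ct; rewrite unlock onepowR mulr1.
rewrite (powRr1 (ltW C00)) (powRr1 (dX_ge0 _ _ _ _)).
under eq_integral do rewrite powRr1//.
move=> /le_trans; apply; rewrite lee_fin ler_wpM2l ?(ltW C00)//.
rewrite -[leLHS]ger0_norm ?dX_ge0// -sqrtr_sqr ler_wsqrtr//.
apply: le_trans (dXK cs ct st) _; rewrite ler_wpM2l ?(ltW K0)//.
have e0 j : 0 <= 2 * alpha j - alpha j by have := alpha0 j; lra.
rewrite /prod_dist (bigD1 k)//= -[leRHS]mulr1 ler_pM ?powR_ge0 ?prodr_ge0//.
- have -> : 2 * alpha k - alpha k = alpha k by ring.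
  by rewrite ge0_ler_powR ?nnegrE ?(ltW (alpha0 k)).
- apply: prodr_ile1 => j _; rewrite powR_ge0 /= -[leRHS](onepowR (2 * alpha j - alpha j)).
  by rewrite ge0_ler_powR ?nnegrE// cube_dist_le1.
Qed.

Lemma mean_reduct_trunc_le t N : cube t ->
  (\int[P]_w `|reduct (X ^~ w) (trunc_pt N t) - reduct (X ^~ w) t|%:E <=
   (\sum_k C0 * Num.sqrt (K * (2 ^- N) `^ alpha k))%:E)%E.
Proof.
move=> ct; have cN := cube_trunc_pt N ct.
pose s k := mixed k t (trunc_pt N t); pose p k := upd k (t ord0 k) 0 : 'rV[R]_n.
have cs k : cube (s k) by exact: cube_mixed.
have cp k : cube (p k) by apply: cube_upd; [exact: ct|exact: cube0].
have mi k : measurable_fun [set: T] (fun w => `|increment X (p k) (s k) w|%:E).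
  by apply/measurable_EFinP; apply: measurableT_comp => //; exact: measurable_increment.
apply: (@le_trans _ _ (\int[P]_w \sum_(k < n) `|increment X (p k) (s k) w|%:E)%E).
  apply: ge0_le_integral => //.
  - apply/measurable_EFinP; apply: measurableT_comp => //.
    by apply: measurable_funB; exact: measurable_reduct.
  - by apply: emeasurable_sum => k; exact: mi.
  - by move=> w _; rewrite reduct_telescope sumEFin lee_fin ler_norm_sum.
rewrite ge0_integral_sum// -sumEFin; apply: lee_sum => k _.
apply: mean_increment_le => //.
rewrite /p /s updE eqxx mxE ltnn trunc_ptE; apply: dist_dytrunc.
by have /andP[] := ct k.
Qed.

Lemma measurable_limn_einf (u : nat -> T -> \bar R) :
  (forall N, measurable_fun [set: T] (u N)) ->
  measurable_fun [set: T] (fun w => limn_einf (u ^~ w)).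
Proof.
move=> mu; rewrite (_ : (fun w => _) = (fun w => - limn_esup (fun N => - u N w))%E); last first.
  by apply/funext => w; rewrite [X in (- X)%E](limn_esupN (u ^~ w)) oppeK.
apply: measurableT_comp => //; apply: measurable_fun_limn_esup => N.
exact: measurableT_comp.
Qed.

Lemma mean_reduct_trunc_cvg0 t : cube t ->
  (\int[P]_w `|reduct (X ^~ w) (trunc_pt N t) - reduct (X ^~ w) t|%:E)%E @[N --> \oo] --> 0%E.
Proof.
move=> ct; apply: (@squeeze_cvge _ _ _ _ (cst 0%E) _
  (fun N => (\sum_k C0 * Num.sqrt (K * (2 ^- N) `^ alpha k))%:E)).
- apply: nearW => N; rewrite mean_reduct_trunc_le// andbT.
  by apply: integral_ge0 => w _; rewrite lee_fin.
- exact: cvg_cst.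
- apply: cvg_EFin => //; first by exact: nearW.
  rewrite /comp /=.
  rewrite [X in _ --> X](_ : _ = \sum_(k < n) (C0 * (Num.sqrt K * 0))); last first.
    by rewrite big1// => k _; rewrite !mulr0.
  apply: (cvg_big add_continuous) => k _; apply: cvgM; first exact: cvg_cst.
  under eq_fun do rewrite sqrtrM ?(ltW K0)//; apply: cvgM; first exact: cvg_cst.
  under eq_fun do rewrite -powR12_sqrt ?powR_ge0// -powRrM.
  by apply: cvg_exp2V_powR; rewrite divr_gt0.
Qed.

(** Along the truncations [reduct X] tends to [reduct_lim] almost surely and to its value at [t] in
    mean; Fatou's lemma identifies the two limits. *)
Lemma regular_ae t : cube t ->
  {ae P, forall w, cvg (reduct (X ^~ w) (trunc_pt N t) @[N --> \oo])} ->
  {ae P, forall w, regular t w = X t w}.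
Proof.
move=> ct cvg_ae; pose D w := `|reduct_lim t w - reduct (X ^~ w) t|%:E.
pose u N w := `|reduct (X ^~ w) (trunc_pt N t) - reduct (X ^~ w) t|%:E.
have mD : measurable_fun [set: T] D.
  apply/measurable_EFinP; apply: measurableT_comp => //; apply: measurable_funB.
    exact: measurable_reduct_lim.
  exact: measurable_reduct.
have mu N : measurable_fun [set: T] (u N).
  apply/measurable_EFinP; apply: measurableT_comp => //; apply: measurable_funB.
    by apply: measurable_reduct; exact: cube_trunc_pt.
  exact: measurable_reduct.
have DE : {ae P, forall w, D w = limn_einf (u ^~ w)}.
  apply: filterS cvg_ae => w /reduct_limP Hw; apply/esym.
  apply: (cvg_limn_einf_sup (l := D w) _).1; apply: cvg_EFin => //; first by exact: nearW.
  by apply: cvg_norm; apply: cvgB => //; exact: cvg_cst.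
have : (\int[P]_w D w = 0)%E.
  apply/eqP; rewrite eq_le; apply/andP; split; last by apply: integral_ge0 => w _; rewrite lee_fin.
  rewrite (ae_eq_integral (fun w => limn_einf (u ^~ w)))//; last 2 first.
  - exact: measurable_limn_einf.
  - by apply: filterS DE => w.
  apply: le_trans (fatou P measurableT mu _) _; first by move=> N w _; rewrite lee_fin.
  by rewrite (cvg_limn_einf_sup (mean_reduct_trunc_cvg0 ct)).1.
rewrite (eq_integral (fun w => `|D w|%E)); last by move=> w _; rewrite /D /= normr_id.
move/(ae_eq_integral_abs P measurableT mD); apply: filterS => w /(_ Logic.I) /= [].
by move=> /normr0_eq0; rewrite /regular -[reduct _ _ - _]opprB => ->; rewrite oppr0 subr0.
Qed.

End regular_modification.

(** * Both implications *)

Section existence.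
Context {R : realType} {n : nat} {d : measure_display} {T : measurableType d}.
Variable P : probability T R.
Implicit Types (X Y : 'rV[R]_n -> T -> R) (alpha eps : 'I_n -> R).

Lemma ae_modification X Y : random_field X -> random_field Y ->
  (forall t, cube t -> {ae P, forall w, Y t w = X t w}) -> modification P X Y.
Proof.
move=> mX mY XY; split => // t ct.
have mE := measurable_eq_set (mY t ct) (mX t ct).
have : P (~` [set w | Y t w = X t w]) = 0%E.
  by apply/negligibleP; [exact: measurableC|exact: XY].
by rewrite [X in X = _ -> _]probability_setC// => /eqP; rewrite sube_eq// add0e => /eqP <-.
Qed.

Variables (C0 iota : R) (alpha : 'I_n -> R) (X : 'rV[R]_n -> T -> R).
Hypotheses (C00 : 0 < C0) (alpha0 : forall j, 0 < alpha j).
Hypotheses (mX : random_field X) (momX : moment_growth P C0 iota X).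
Hypothesis dXb : forall eps, (forall j, 0 < eps j) ->
  exists C, 0 < C /\ dX_bound P alpha eps C X.

Lemma exists_holder_modification :
  exists Y, modification P X Y /\ jointly_holder P alpha Y.
Proof.
have paths eps : (forall j, 0 < eps j) -> let e := small_eps alpha eps in
  {ae P, forall w, holder_sup X alpha e w \is a fin_num} /\
  forall w, holder_sup X alpha e w \is a fin_num ->
    let c := box_const (fun j => alpha j - e j) * fine (holder_sup X alpha e w) in
    0 <= c /\ box_holder dyadic (fun j => alpha j - e j) c (X ^~ w).
  move=> eps0 e; have eP := small_epsP alpha0 eps0.
  have e0 j : 0 < e j by have [] := eP j.
  have ea j : e j < alpha j by have [] := eP j.
  have [K [K0 dK]] := dXb e0; split.
    exact: (holder_sup_fin C00 K0 e0 mX momX dK).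
  move=> w fin c; split; last exact: holder_sup_dyadic.
  rewrite mulr_ge0//; first by apply: box_const_ge0 => j; rewrite subr_gt0.
  by rewrite fine_ge0// holder_sup_ge0.
have gam0 eps : (forall j, 0 < eps j) -> forall j, 0 < alpha j - small_eps alpha eps j.
  by move=> e0 j; have [_ ? _] := small_epsP alpha0 e0 j; rewrite subr_gt0.
(* This field does not depend on [eps], so one modification serves all orders at once; the choice
   [eps = alpha] is enough to show that it is a modification. *)
exists (regular X); split.
  apply: ae_modification => //; first exact: random_field_regular.
  move=> t ct; have [K [K0 dK]] := dXb alpha0; apply: (regular_ae mX C00 K0 alpha0 momX dK ct).
  have [fin pth] := paths _ alpha0; apply: filterS fin => w /pth[c0 H].
  exact: reduct_trunc_cauchy (gam0 _ alpha0) c0 H _ ct.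
move=> eps eps0; have [fin pth] := paths _ eps0; set e := small_eps alpha eps in fin pth.
exists (fun w => (box_const (fun j => alpha j - e j))%:E * holder_sup X alpha e w)%E; split.
- by apply: emeasurable_funM => //; exact: measurable_holder_sup.
- by apply: filterS fin => w f; rewrite fin_numM.
- apply: filterS fin => w f s t cs ct st; have [c0 H] := pth w f.
  rewrite -[X in (_%:E * X)%E]fineK// -!EFinM lee_fin.
  apply: le_trans (box_holder_regular (gam0 _ eps0) c0 H cs ct st) _.
  rewrite ler_wpM2l// prod_dist_le// => j.
  by have [_ _] := small_epsP alpha0 eps0 j; rewrite lerD2l lerN2.
Qed.

End existence.

(** * From Hoelder paths to the bound on [dX] *)

Section necessity.
Context {R : realType} {n : nat} {d : measure_display} {T : measurableType d}.
Variable P : probability T R.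

(** The events [k < C w] decrease to the null event that [C w] is [+oo], so continuity from above
    applies. *)
Lemma fin_num_tail (C : T -> \bar R) (delta : R) : measurable_fun [set: T] C ->
  {ae P, forall w, C w \is a fin_num} -> 0 < delta ->
  exists2 L : R, 0 <= L & (P [set w | L%:E < C w] <= delta%:E)%E.
Proof.
move=> mC fin d0; pose F (k : nat) := [set w | (k%:R%:E < C w)%E].
have mF k : measurable (F k).
  rewrite /F -[X in measurable X]setTI; have := emeasurable_fun_o_infty measurableT mC k%:R%:E.
  by [].
have F0 : P (\bigcap_k F k) = 0%E.
  apply/negligibleP; first exact: bigcapT_measurable.
  apply: negligibleS fin => w Fw /=; case E : (C w) => [r| |]//.
  have := Fw (Num.truncn r).+1 I; rewrite /F /= E lte_fin => /lt_trans/(_ (truncnS_gt r)).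
  by rewrite ltxx.
have cvgF : P (F k) @[k --> \oo] --> 0%E.
  rewrite -F0; apply: nonincreasing_cvg_mu => //.
  - by rewrite -ge0_fin_numE// fin_num_measure.
  - exact: bigcapT_measurable.
  - move=> a b ab; apply/subsetPset => w; apply: le_lt_trans.
    by rewrite lee_fin ler_nat.
have [k Hk] : exists k, (P (F k) <= delta%:E)%E.
  apply: contrapT => /forallNP H; have : (delta%:E <= limn (P \o F))%E.
    apply: lime_ge; first by apply/cvg_ex; exists 0%E.
    by apply: nearW => k; apply/ltW; rewrite ltNge; apply/negP; exact: H.
  by rewrite (cvg_lim _ cvgF)// lee_fin leNgt d0.
by exists k%:R.
Qed.

Variables (C0 iota : R) (alpha : 'I_n -> R) (X : 'rV[R]_n -> T -> R).
Hypotheses (C00 : 0 < C0).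
Hypotheses (mX : random_field X) (sqX : square_integrable_increments P X).
Hypothesis momX : moment_growth P C0 iota X.

(** Square integrability excludes the case in which [fine] would turn an infinite second moment into
    0. *)
Lemma dX_sqr s t : cube s -> cube t ->
  ((dX P X t s ^+ 2)%:E = \int[P]_w (`|increment X t s w| ^+ 2)%:E)%E.
Proof.
move=> cs ct; have E0 : (0 <= 'E_P[fun w => (`|increment X t s w| ^+ 2)%R])%E.
  by rewrite unlock; apply: integral_ge0 => w _; rewrite lee_fin exprn_ge0.
rewrite /dX sqr_sqrtr ?fine_ge0// fineK; first by rewrite unlock.
by rewrite ge0_fin_numE// sqX.
Qed.

(* A Paley-Zygmund argument: the fourth moment controls the second moment on an
   event of small probability, hence [d_X] is governed by the complement. *)
Lemma dX_le_of_large_event s t (F : set T) (b : R) :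
  cube s -> cube t -> measurable F -> 0 <= b ->
  (P F <= (4 * (C0 `^ 4 * 4 `^ (4 * iota)))^-1%:E)%E ->
  {ae P, forall w, ~ F w -> `|increment X t s w| <= b} ->
  dX P X t s ^+ 2 <= 2 * b ^+ 2.
Proof.
move=> cs ct mF b0; set kap := C0 `^ 4 * _ => PF hb.
have kap0 : 0 < kap by rewrite mulr_gt0 ?powR_gt0.
set D := dX P X t s; have [D0|D0] := eqVneq D 0.
  by rewrite D0 expr0n mulr_ge0// exprn_ge0.
have D2 : 0 < D ^+ 2 by rewrite exprn_gt0// lt_neqAle eq_sym D0 dX_ge0.
have mI : measurable_fun [set: T] (fun w => `|increment X t s w|).
  by apply: measurableT_comp => //; exact: measurable_increment.
(* Since [a * c = 1/4], [z ^ 2 <= a * z ^ 4 + c] for every [z]; this plays the role of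
   Cauchy-Schwarz on [F]. The weights are balanced so that [a] times the fourth moment and [c] times
   the probability of [F] are each at most [D ^ 2 / 4], which leaves
   [D ^ 2 <= b ^ 2 + D ^ 2 / 2]. *)
pose a := (4 * kap * D ^+ 2)^-1; have a0 : 0 <= a by rewrite invr_ge0 (mulr_ge0 _ (ltW D2))// mulr_ge0// ltW.
pose c := kap * D ^+ 2; have c0 : 0 <= c by exact: mulr_ge0 (ltW kap0) (ltW D2).
have m4 : measurable_fun [set: T] (fun w => (`|increment X t s w| `^ 4)%:E).
  by apply/measurable_EFinP; exact: (measurableT_comp (measurable_powR 4)).
have mi : measurable_fun [set: T] (fun w => (\1_F w : R)%:E).
  by apply/measurable_EFinP.
have i0 w : (0 <= (\1_F w : R)%:E)%E by rewrite lee_fin.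
have ind0 w : 0 <= \1_F w :> R by rewrite indicE.
have p0 w : (0 <= (`|increment X t s w| `^ 4)%:E)%E by rewrite lee_fin powR_ge0.
have sum0 w : 0 <= a * `|increment X t s w| `^ 4 + c * \1_F w.
  by apply: addr_ge0; apply: mulr_ge0; rewrite ?powR_ge0.
have le1 : (\int[P]_w (`|increment X t s w| ^+ 2)%:E <=
   \int[P]_w ((b ^+ 2)%:E + (a%:E * (`|increment X t s w| `^ 4)%:E + c%:E * (\1_F w : R)%:E)))%E.
  apply: ae_ge0_le_integral => //.
  - by apply/measurable_EFinP; exact: measurable_funX.
  - by move=> w _; rewrite -!EFinM -!EFinD lee_fin addr_ge0 ?sum0// exprn_ge0.
  - apply: emeasurable_funD => //; apply: emeasurable_funD; exact: emeasurable_funM.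
  - apply: filterS hb => w hw _; rewrite -!EFinM -!EFinD lee_fin.
    set z := `|increment X t s w|; have z0 : 0 <= z by exact: normr_ge0.
    rewrite (_ : z `^ 4 = z ^+ 4) ?powR_mulrn// indicE.
    have [Fw|/negP nFw] := boolP (w \in F).
      rewrite mulr1; have : z ^+ 2 <= a * z ^+ 4 + c.
        rewrite -subr_ge0 (_ : _ - _ = a * (z ^+ 2 - 2 * kap * D ^+ 2) ^+ 2).
          by rewrite mulr_ge0// sqr_ge0.
        by rewrite /a /c; field; rewrite D0 gt_eqF.
      by move/le_trans; apply; rewrite lerDr exprn_ge0.
    rewrite mulr0 addr0; have zb : z <= b by apply: hw => /mem_set.
    by rewrite -[leLHS]addr0 lerD ?mulr_ge0 ?exprn_ge0// lerXn2r ?nnegrE.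
have mz : measurable_fun [set: T] (fun w => a%:E * (`|increment X t s w| `^ 4)%:E)%E.
  exact: emeasurable_funM.
have mF' : measurable_fun [set: T] (fun w => c%:E * (\1_F w : R)%:E)%E by exact: emeasurable_funM.
have z0 w : (0 <= a%:E * (`|increment X t s w| `^ 4)%:E)%E by rewrite mule_ge0.
have F0 w : (0 <= c%:E * (\1_F w : R)%:E)%E by rewrite mule_ge0.
move: le1; rewrite -dX_sqr// ge0_integralD => //; last first.
- exact: emeasurable_funD.
- by move=> w _; rewrite adde_ge0.
- by move=> w _; rewrite lee_fin exprn_ge0.
rewrite ge0_integralD//.
rewrite !ge0_integralZl_EFin// integral_indic// setIT.
have := momX (ler1n R 4) cs ct; rewrite unlock -/D => M4 le1.
have E4 : D `^ 4 = D ^+ 2 * D ^+ 2 by rewrite powR_mulrn ?dX_ge0// -exprD.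
have : ((D ^+ 2)%:E <= (b ^+ 2)%:E + (a%:E * (kap * (D ^+ 2 * D ^+ 2))%:E + c%:E * (4 * kap)^-1%:E))%E.
  apply: le_trans le1 _; apply: leeD.
    rewrite integral_cst// -[leRHS]mule1; apply: lee_wpmul2l.
      by rewrite lee_fin exprn_ge0.
    by rewrite [leLHS](probability_setT P).
  by rewrite leeD// lee_wpmul2l// -E4.
rewrite -!EFinM -!EFinD lee_fin.
have -> : a * (kap * (D ^+ 2 * D ^+ 2)) = D ^+ 2 / 4 by rewrite /a; field; rewrite D0 gt_eqF.
have -> : c / (4 * kap) = D ^+ 2 / 4 by rewrite /c; field; rewrite gt_eqF.
lra.
Qed.

(** The order [alpha - eps / 2] squares to [2 * alpha - eps]. The admissible probability of the bad
    event depends only on [C0] and [iota], so a single level [L] works for all [s] and [t]. *)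
Lemma dX_bound_of_holder : jointly_holder P alpha X ->
  forall eps, (forall j, 0 < eps j) -> exists C : R, 0 < C /\ dX_bound P alpha eps C X.
Proof.
move=> HX eps eps0; have [|C [mC fin hC]] := HX (fun j => eps j / 2).
  by move=> j; rewrite divr_gt0.
have d0 : 0 < (4 * (C0 `^ 4 * 4 `^ (4 * iota)))^-1 :> R.
  by rewrite invr_gt0 !mulr_gt0 ?powR_gt0.
have [L L0 PL] := fin_num_tail mC fin d0.
(* The summand 1 makes the constant positive even when [L = 0]. *)
exists (2 * L ^+ 2 + 1); split; first by rewrite ltr_wpDl// mulr_ge0// exprn_ge0.
move=> s t cs ct st; set pi := prod_dist (fun j => alpha j - eps j / 2) s t.
have E : prod_dist (fun j => 2 * alpha j - eps j) s t = pi ^+ 2.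
  rewrite expr2 /pi -big_split; apply: eq_bigr => j _ /=.
  have d0' : `|t ord0 j - s ord0 j| != 0 by rewrite normr_eq0 subr_eq0 eq_sym st.
  by rewrite -powRD ?d0' ?implybT//; congr (_ `^ _); field.
rewrite E; have pi0 : 0 <= pi by exact: prod_dist_ge0.
apply: le_trans (dX_le_of_large_event (F := [set w | (L%:E < C w)%E]) (b := L * pi) cs ct _ _ PL _) _.
- rewrite -[X in measurable X]setTI; exact: emeasurable_fun_o_infty.
- by rewrite mulr_ge0.
- apply: filterS2 fin hC => w fw hw /negP; rewrite -leNgt => CL.
  have := hw s t cs ct st; rewrite -/pi -lee_fin => /le_trans; apply.
  by rewrite EFinM lee_wpmul2r// lee_fin.
- rewrite exprMn mulrA ler_wpM2r ?exprn_ge0// lerDl//.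
Qed.

End necessity.

(** * The Hoelder constant *)

Section holder_constant.
Context {R : realType} {n : nat} {d : measure_display} {T : measurableType d}.
Variable P : probability T R.
Variables (alpha eps : 'I_n -> R) (X : 'rV[R]_n -> T -> R).
Hypotheses (alpha0 : forall j, 0 < alpha j) (eps0 : forall j, 0 < eps j).
Hypotheses (mX : random_field X) (hX : jointly_holder P alpha X).

(** The minimum makes every pair code a dyadic point of the unit interval, so a countable type
    without side condition indexes them all. *)
Definition dyadic_of (c : nat * nat) : R := (minn c.2 (2 ^ c.1))%:R / 2 ^+ c.1.

Lemma dyadic_dyadic_of c : dyadic (dyadic_of c).
Proof. by exists c.1, (minn c.2 (2 ^ c.1)); rewrite geq_minr. Qed.

Lemma dyadic_ofP u : dyadic u -> exists c, u = dyadic_of c.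
Proof. by move=> [m [i [im ->]]]; exists (m, i); rewrite /dyadic_of /= (minn_idPl im). Qed.

Let code := {ffun 'I_n -> nat * nat}.

Definition dyadic_pt (a : code) : 'rV[R]_n := \row_j dyadic_of (a j).

Lemma dyadic_dyadic_pt a j : dyadic (dyadic_pt a ord0 j).
Proof. by rewrite mxE; exact: dyadic_dyadic_of. Qed.

Lemma cube_dyadic_pt a : cube (dyadic_pt a).
Proof. by apply: dyadic_cube; exact: dyadic_dyadic_pt. Qed.

Lemma dyadic_ptP (s : 'rV[R]_n) : (forall j, dyadic (s ord0 j)) -> exists a, s = dyadic_pt a.
Proof.
move=> ds; have /choice[a sa] : forall j, exists c, s ord0 j = dyadic_of c.
  by move=> j; exact: dyadic_ofP.
by exists (finfun a); apply: row_ext => j; rewrite mxE ffunE.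
Qed.

Definition ratio (s t : 'rV[R]_n) w : R :=
  `|increment X t s w| / prod_dist (fun j => alpha j - eps j) s t.

Lemma ratio_ge0 s t w : 0 <= ratio s t w.
Proof. by rewrite divr_ge0// prod_dist_ge0. Qed.

Lemma ratio_not_apart s t w : ~ apart s t -> ratio s t w = 0.
Proof.
move=> /existsNP[j /negP]; rewrite negbK => /eqP stj.
by rewrite /ratio /increment (box_eq0 _ stj) normr0 mul0r.
Qed.

(** The value 0 at numbers that code no pair leaves the supremum unchanged, ratios being
    nonnegative. *)
Definition dyadic_ratio (k : nat) w : R :=
  if (unpickle k : option (code * code)) is Some (a, b)
  then ratio (dyadic_pt a) (dyadic_pt b) w else 0.

Definition dyadic_holder_constant w : \bar R :=
  ereal_sup (range (fun k => (dyadic_ratio k w)%:E)).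

Lemma measurable_dyadic_holder_constant : measurable_fun [set: T] dyadic_holder_constant.
Proof.
apply: measurable_ereal_sup => k; apply/measurable_EFinP; rewrite /dyadic_ratio.
case: unpickle => [[a b]|]; last exact: measurable_cst.
apply: measurable_funM => //; apply: measurableT_comp => //.
by apply: measurable_increment => //; exact: cube_dyadic_pt.
Qed.

Lemma dyadic_ratio_ge0 k w : 0 <= dyadic_ratio k w.
Proof. by rewrite /dyadic_ratio; case: unpickle => [[a b]|]//; exact: ratio_ge0. Qed.

Lemma dyadic_holder_constant_ge0 w : (0 <= dyadic_holder_constant w)%E.
Proof.
apply: le_trans (ereal_sup_ubound _) => /=; last by exists 0%N.
by rewrite lee_fin dyadic_ratio_ge0.
Qed.

Lemma ratio_le_dyadic_holder_constant (s t : 'rV[R]_n) w :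
  (forall j, dyadic (s ord0 j)) -> (forall j, dyadic (t ord0 j)) ->
  ((ratio s t w)%:E <= dyadic_holder_constant w)%E.
Proof.
move=> /dyadic_ptP[a ->] /dyadic_ptP[b ->]; apply: ereal_sup_ubound.
by exists (pickle (a, b)) => //; rewrite /dyadic_ratio pickleK.
Qed.

Lemma dyadic_holder_constant_le (c : \bar R) w : (0 <= c)%E ->
  (forall s t : 'rV[R]_n, (forall j, dyadic (s ord0 j)) -> (forall j, dyadic (t ord0 j)) ->
    apart s t -> ((ratio s t w)%:E <= c)%E) ->
  (dyadic_holder_constant w <= c)%E.
Proof.
move=> c0 H; apply: ub_ereal_sup => _ [k _ <-]; rewrite /dyadic_ratio.
case: unpickle => [[a b]|]//.
have [ab|nab] := pselect (apart (dyadic_pt a) (dyadic_pt b)).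
  by apply: H => // j; exact: dyadic_dyadic_pt.
by rewrite ratio_not_apart.
Qed.

(** The Hoelder order [gam] only supplies convergence of the increments along truncations, so that
    each ratio is a limit of dyadic ratios; the exponents [alpha - eps] inside the ratio may be
    negative. *)
Lemma holder_constantE w (gam : 'I_n -> R) c : (forall j, 0 < gam j) -> 0 <= c ->
  box_holder (fun u => 0 <= u <= 1) gam c (X ^~ w) ->
  dyadic_holder_constant w = holder_constant alpha eps X w.
Proof.
move=> g0 c0 H; apply/eqP; rewrite eq_le; apply/andP; split.
  have ge (s t : 'rV[R]_n) : cube s -> cube t -> apart s t ->
      ((ratio s t w)%:E <= holder_constant alpha eps X w)%E.
    by move=> cs ct st; apply: ereal_sup_ubound; exists (s, t).
  apply: dyadic_holder_constant_le => [|s t ds dt st]; last first.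
    by apply: ge => //; exact: dyadic_cube.
  (* The origin and the opposite corner form an admissible pair, so the supremum is nonnegative. *)
  apply: le_trans (ge 0 (const_mx 1) cube0 _ _).
  - by rewrite lee_fin ratio_ge0.
  - by move=> j; rewrite mxE lexx ler01.
  - by move=> j; rewrite !mxE eq_sym oner_eq0.
apply: ub_ereal_sup => _ [[s t] [/= cs ct st] <-].
have := dyadic_holder_constant_ge0 w.
case E : (dyadic_holder_constant w) => [m| |]// _; last by rewrite leey.
rewrite lee_fin.
have b : `|box (trunc_pt N t) (X ^~ w) (trunc_pt N s)| @[N --> \oo] --> `|box t (X ^~ w) s|.
  apply: cvg_norm; rewrite -(box_reduct t); apply: box_trunc_cvg => // y cy.
  exact: reduct_trunc_cvg g0 c0 H y cy.
have p : (prod_dist (fun j => alpha j - eps j) (trunc_pt N s) (trunc_pt N t))^-1 @[N --> \oo] -->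
    (prod_dist (fun j => alpha j - eps j) s t)^-1.
  apply: cvgV; first by rewrite gt_eqF// prod_dist_gt0.
  exact: cvg_prod_dist.
have q : ratio (trunc_pt N s) (trunc_pt N t) w @[N --> \oo] --> ratio s t w by exact: cvgM.
apply: (ler_cvg_to q (cvg_cst m)); apply: nearW => N.
by rewrite -lee_fin -E ratio_le_dyadic_holder_constant//; exact: dyadic_trunc_pt.
Qed.

Lemma holder_constant_ae :
  {ae P, forall w, dyadic_holder_constant w = holder_constant alpha eps X w}.
Proof.
have a2 j : 0 < alpha j / 2 by rewrite divr_gt0.
have [C [_ fin hC]] := hX a2; apply: filterS2 fin hC => w fw hw.
(* The random constant [C] carries no sign condition, hence the absolute value. *)
apply: (@holder_constantE w (fun j => alpha j / 2) `|fine (C w)|) => // s t cs ct st.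
have := hw s t cs ct st; rewrite -[X in (_ <= X * _)%E]fineK// -EFinM lee_fin.
move=> /le_trans; apply; rewrite (_ : (fun j => alpha j - alpha j / 2) = fun j => alpha j / 2).
  by rewrite ler_wpM2r ?prod_dist_ge0// ler_norm.
by apply/funext => j; field.
Qed.

Variables (C0 iota K : R).
Hypotheses (C00 : 0 < C0) (iota_gt0 : 0 < iota) (K0 : 0 < K).
Hypothesis momX : moment_growth P C0 iota X.
Let e := small_eps alpha eps.
Hypothesis dXK : dX_bound P alpha e K X.

Let e_gt0 j : 0 < e j. Proof. by have [] := small_epsP alpha0 eps0 j. Qed.
Let e_lt j : e j < alpha j. Proof. by have [] := small_epsP alpha0 eps0 j. Qed.
Let e_le j : e j <= eps j. Proof. by have [] := small_epsP alpha0 eps0 j. Qed.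

Definition holder_factor : R := box_const (fun j => alpha j - e j).

Lemma holder_factor_ge0 : 0 <= holder_factor.
Proof. by apply: box_const_ge0 => j; rewrite subr_gt0. Qed.

Lemma dyadic_holder_constant_le_sup w : holder_sup X alpha e w \is a fin_num ->
  (dyadic_holder_constant w <= (holder_factor * fine (holder_sup X alpha e w))%:E)%E.
Proof.
move=> fin; have m0 : 0 <= holder_factor * fine (holder_sup X alpha e w).
  by rewrite mulr_ge0 ?holder_factor_ge0// fine_ge0// holder_sup_ge0.
apply: dyadic_holder_constant_le => [|s t ds dt st]; first by rewrite lee_fin.
rewrite lee_fin ler_pdivrMr ?prod_dist_gt0//.
apply: le_trans (holder_sup_dyadic e_lt fin ds dt st) _.
by rewrite ler_wpM2l// prod_dist_le//; [exact: dyadic_cube|exact: dyadic_cube|move=> j; rewrite lerD2l lerN2].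
Qed.

(** The constants met on the way, raised to the power [1 / iota]: [holder_factor] from chaining, 2
    from comparing [supU] with one [maxU N], and [scale_const] from the moments; [expR 1 / iota]
    comes from [k ^ k / k!] and [p = k / iota]. *)
Definition exp_rate : R :=
  holder_factor `^ iota^-1 * (2 `^ iota^-1 * (scale_const C0 K `^ iota^-1 / iota * expR 1)).

Lemma holder_constant_exp_moment (beta : R) : 0 < beta -> beta * exp_rate <= 2^-1 ->
  (\int[P]_w expeR (beta%:E * poweR (dyadic_holder_constant w) iota^-1) < +oo)%E.
Proof.
move=> beta0 hb; have k0 : 0 < iota^-1 by rewrite invr_gt0.
pose b := beta * holder_factor `^ iota^-1; have b0 : 0 <= b by rewrite mulr_ge0 ?powR_ge0// ltW.
have bB : b * 2 `^ iota^-1 * (scale_const C0 K `^ iota^-1 / iota * expR 1) <= 2^-1.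
  by apply: le_trans hb; rewrite /exp_rate /b !mulrA.
have mom := scaled_moment C00 K0 e_gt0 mX momX dXK.
have msc : forall h, measurable_fun [set: T] (scaled X alpha e h) by exact: measurable_scaled.
have := supU_exp_moment msc (moment_threshold_ge1 e_gt0) mom iota_gt0 b0 bB.
apply: le_lt_trans; apply: ae_ge0_le_integral => //.
- by move=> w _; exact: expeR_ge0.
- apply: measurable_expeR_comp; apply: emeasurable_funM => //.
  apply: (measurableT_comp (measurable_poweR _)).
  exact: measurable_dyadic_holder_constant.
- by move=> w _; exact: expeR_ge0.
- apply: measurable_expeR_comp; apply: emeasurable_funM => //.
  by apply: (measurableT_comp (measurable_poweR _)); exact: measurable_supU.
apply: filterS (holder_sup_fin C00 K0 e_gt0 mX momX dXK) => w fin _.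
have := dyadic_holder_constant_le_sup fin; have := dyadic_holder_constant_ge0 w.
case: (dyadic_holder_constant w) => [c| |]//; rewrite !lee_fin => c0 cm.
have m0 := fine_ge0 (holder_sup_ge0 X alpha e w).
rewrite -/(holder_sup X alpha e w) -[X in (_ <= expeR (_ * poweR X _))%E]fineK//.
rewrite !poweR_EFin -!EFinM /= lee_fin ler_expR /b -mulrA -powRM ?holder_factor_ge0//.
rewrite ler_wpM2l ?(ltW beta0)// ge0_ler_powR ?nnegrE ?(ltW k0)//.
by rewrite mulr_ge0// holder_factor_ge0.
Qed.

End holder_constant.

(* The threshold beta0 is uniform over all probability spaces and all fields: it
   depends on C0, alpha, iota, eps and on the family K of constants in the bound
   on d_X^2, but on nothing else (X |-> c X preserves the moment hypothesis and
   multiplies the Hoelder constant by |c|, so K cannot be dropped).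
   The supremum defining the Hoelder constant is uncountable, so its measurability
   up to a null set is part of the claim. *)
Theorem theorem2p20 (R : realType) (n : nat) (hn : (0 < n)%N)
    (C0 iota : R) (hC0 : 0 < C0) (hiota : 0 <= iota)
    (alpha : 'I_n -> R) (halpha : forall j, 0 < alpha j) :
  (forall (d : measure_display) (T : measurableType d) (P : probability T R)
      (X : 'rV[R]_n -> T -> R),
    random_field X ->
    square_integrable_increments P X ->
    moment_growth P C0 iota X ->
    ((exists Y, modification P X Y /\ jointly_holder P alpha Y) <->
     (forall eps : 'I_n -> R, (forall j, 0 < eps j) ->
        exists C : R, 0 < C /\ dX_bound P alpha eps C X)))
  /\
  (0 < iota ->
   forall eps : 'I_n -> R, (forall j, 0 < eps j) ->
   forall K : ('I_n -> R) -> R,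
   exists beta0 : R, 0 < beta0 /\
   forall (d : measure_display) (T : measurableType d) (P : probability T R)
      (X : 'rV[R]_n -> T -> R),
    random_field X ->
    square_integrable_increments P X ->
    moment_growth P C0 iota X ->
    (forall eps' : 'I_n -> R, (forall j, 0 < eps' j) ->
       0 < K eps' /\ dX_bound P alpha eps' (K eps') X) ->
    forall Y, modification P X Y -> jointly_holder P alpha Y ->
    exists C : T -> \bar R,
      [/\ measurable_fun [set: T] C,
          {ae P, forall w, C w = holder_constant alpha eps Y w} &
          forall beta : R, 0 < beta -> beta <= beta0 ->
            (\int[P]_w expeR (beta%:E * poweR (C w) iota^-1) < +oo)%E]).
Proof.
split.
  move=> d T P X mX sqX momX; split; last exact: (exists_holder_modification hC0 halpha mX momX).
  move=> [Y [XY hY]] eps eps0; have mY := XY.1.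
  have sqY := square_integrable_modification mX XY sqX.
  have momY := moment_growth_modification mX XY momX.
  have [C [C_gt0 HC]] := dX_bound_of_holder hC0 mY sqY momY hY eps0.
  exists C; split => // s t cs ct st.
  by rewrite -(dX_modification mX XY cs ct); exact: HC.
move=> iota0 eps eps0 K; set e := small_eps alpha eps.
have e0 j : 0 < e j by have [] := small_epsP halpha eps0 j.
pose A := exp_rate alpha eps C0 iota (K e).
have A0 : 0 <= A.
  by rewrite /A /exp_rate !mulr_ge0 ?powR_ge0 ?invr_ge0 ?(ltW iota0) ?expR_ge0.
have A1 : 0 < 2 * (A + 1) by rewrite mulr_gt0// ltr_wpDl.
(* Then [beta * A <= 1/2], as the exponential bound requires; the summand 1 avoids division by 0
   when [A = 0]. Only the deterministic data enter [A], so the threshold is chosen before the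
   probability space. *)
exists (2 * (A + 1))^-1; split; first by rewrite invr_gt0.
move=> d T P X mX sqX momX dXK Y XY hY; have mY := XY.1.
have momY := moment_growth_modification mX XY momX.
have [K0 dK] := dXK e e0; have dKY := dX_bound_modification mX XY dK.
exists (dyadic_holder_constant alpha eps Y); split.
- exact: measurable_dyadic_holder_constant.
- exact: holder_constant_ae.
- move=> beta beta0 hb; apply: (holder_constant_exp_moment halpha eps0 mY hC0 iota0 K0) => //.
  apply: le_trans (ler_wpM2r A0 hb) _; rewrite mulrC ler_pdivrMr// mulrA mulVf// mul1r.
  by rewrite lerDl.
Qed.
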